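(* For an arbitrary real $m\times m$ matrix $\mathbb K$, the operator $(\mathbf A,D(\mathbf A))$ generates a $C_0$-semigroup on $\mathbf L_1(I)$. The semigroup is positive if and only if $\mathbb K\ge 0$ (i.e. all entries of $\mathbb K$ are nonnegative).
   Context: Let $I=[0,1]$ and $m\in\mathbb N$. $\mathbf L_1(I)$ and $\mathbf W^1_1(I)$ denote the $m$-fold products of $L_1(I)$ and of the Sobolev space $W^1_1(I)$ (functions in $L_1(I)$ with weak derivative in $L_1(I)$), i.e. spaces of vector functions $\mathbf u=(u_1,\dots,u_m)$. Let $c_1,\dots,c_m>0$ be constants (speeds) and $\mathbb K$ a real $m\times m$ matrix. The operator $\mathbf A$ in $\mathbf L_1(I)$ is given by $\mathbf A\mathbf u=(-c_1\partial_xu_1,\dots,-c_m\partial_xu_m)$ on the domain $$D(\mathbf A)=\{\mathbf u\in\mathbf W^1_1(I);\ \mathbf u(0)=\mathbb K\mathbf u(1)\}.$$ A semigroup on $\mathbf L_1(I)$ is positive if each of its operators maps vector functions with (a.e.) nonnegative components to vector functions with nonnegative components. *)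

(* Defs.v *)
From HB Require Import structures.
From mathcomp Require Import all_boot all_order all_algebra.
From mathcomp Require Import all_classical all_reals all_analysis ess_sup_inf measurable_realfun.

Set Implicit Arguments.
Unset Strict Implicit.
Unset Printing Implicit Defensive.
Import Order.TTheory GRing.Theory Num.Theory.
Import numFieldNormedType.Exports.

Local Open Scope classical_set_scope.
Local Open Scope ring_scope.

(** The library's [LspaceType mu p1] (classes modulo equality mu-a.e. of
    measurable functions with finite p-norm) comes without any algebraic or
    topological structure; we make it a normed module. *)
Section Lspace_normed.
Context d (T : measurableType d) (R : realType).
Variables (mu : {measure set T -> \bar R}) (p : \bar R) (p1 : (1 <= p)%E).

Local Notation Lp := (LspaceType mu p1).

HB.instance Definition _ := gen_eqMixin Lp.
HB.instance Definition _ := gen_choiceMixin Lp.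

Lemma ae_eq_Lnorm (f g : T -> R) :
  measurable_fun setT f -> measurable_fun setT g ->
  f = g %[ae mu] -> 'N[mu]_p[EFin \o f]%E = 'N[mu]_p[EFin \o g]%E.
Proof.
move=> mf mg fg; rewrite unlock; case: p p1 => [r r1| _ |//].
- have mp (h : T -> R) : measurable_fun setT h ->
      measurable_fun [set: T] ((fun x => `|(EFin \o h) x| `^ r)%E : T -> \bar R).
    move=> mh; apply: (measurableT_comp (measurable_poweR r)).
    by apply: measurableT_comp => //; exact/measurable_EFinP.
  congr (_ `^ _)%E; apply: ae_eq_integral => //; [exact: mp..|].
  by apply: filterS fg => x /= /[apply] ->.
- case: ifPn => // _; apply: eq_ess_sup.
  by apply: filterS fg => x /= /(_ I) ->.
Qed.

Lemma Lspace_Lfun (u : Lp) : (u : T -> R) \in Lfun mu p.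
Proof.
apply/andP; split; rewrite inE /=.
  exact: (@measurable_funPT _ _ _ _ (repr (LebesgueSpace.sort u))).
exact: (@Lebesgue_finite _ _ _ _ _ _ u).
Qed.

Lemma Lspace_eqP (u v : Lp) : u = v <-> ((u : T -> R) = v %[ae mu]).
Proof.
split=> [->|]; first exact: aeW.
case: u v => [u [[hu]]] [v [[hv]]] /= /(introT (ae_eqP u v))/eqP; rewrite !reprK => uv.
by subst v; rewrite (Prop_irrelevance hu hv).
Qed.

Lemma Lfun_measurable (f : T -> R) : f \in Lfun mu p -> measurable_fun setT f.
Proof. by case/andP; rewrite inE. Qed.

Section Lspace_of.
Variables (f : T -> R) (Lf : f \in Lfun mu p).

Let mf : {mfun T >-> measurableTypeR R} :=
  @mfun_Sub _ _ T (measurableTypeR R) f (mem_set (Lfun_measurable Lf)).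

Let class_f : {mfun_ mu, T >-> measurableTypeR R} :=
  (\pi_({mfun_ mu, T >-> measurableTypeR R}) mf)%qT.

Let class_fE : (class_f : T -> R) = f %[ae mu].
Proof.
have : (repr class_f == mf %[mod {mfun_ mu, T >-> measurableTypeR R}])%qT.
  by rewrite reprK.
by rewrite eqmodE => /asboolP.
Qed.

Let class_f_fin : finite_norm mu p class_f.
Proof.
rewrite /finite_norm (ae_eq_Lnorm _ (Lfun_measurable Lf) class_fE).
  by case/andP: Lf => _; rewrite inE.
exact: (@measurable_funPT _ _ _ _ (repr class_f)).
Qed.

HB.instance Definition _ :=
  @isFinLebesgue.Build d T R mu p p1 class_f class_f_fin.

Definition Lspace_of : Lp := class_f.

Lemma Lspace_ofE : (Lspace_of : T -> R) = f %[ae mu].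
Proof. exact: class_fE. Qed.

End Lspace_of.

Lemma Lfun_add (f g : T -> R) : f \in Lfun mu p -> g \in Lfun mu p ->
  (f \+ g) \in Lfun mu p.
Proof. by move=> Lf Lg; have [_ /(_ f g Lf Lg)] := Lfun_addr_closed mu p1. Qed.

Lemma Lfun_scal (a : R) (f : T -> R) : f \in Lfun mu p ->
  (fun x => a * f x) \in Lfun mu p.
Proof.
move=> Lf; have [L0 /(_ a f 0 Lf L0)] := Lfun_submod_closed mu p1.
by rewrite addr0.
Qed.

Lemma Lfun_zero : cst 0 \in Lfun mu p.
Proof. by have [] := Lfun_addr_closed mu p1. Qed.

Definition Lspace_zero : Lp := Lspace_of Lfun_zero.
Definition Lspace_add (u v : Lp) : Lp :=
  Lspace_of (Lfun_add (Lspace_Lfun u) (Lspace_Lfun v)).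
Definition Lspace_scale (a : R) (u : Lp) : Lp :=
  Lspace_of (Lfun_scal a (Lspace_Lfun u)).
Definition Lspace_opp (u : Lp) : Lp := Lspace_scale (-1) u.

Let addE u v : (Lspace_add u v : T -> R) = (u \+ v) %[ae mu].
Proof. exact: Lspace_ofE. Qed.

Let scaleE a u : (Lspace_scale a u : T -> R) = (fun x => a * u x) %[ae mu].
Proof. exact: Lspace_ofE. Qed.

Let zeroE : (Lspace_zero : T -> R) = cst 0 %[ae mu].
Proof. exact: Lspace_ofE. Qed.

Let addA : associative Lspace_add.
Proof.
move=> u v w; apply/Lspace_eqP.
have h1 := addE u (Lspace_add v w); have h2 := addE v w.
have h3 := addE (Lspace_add u v) w; have h4 := addE u v.
near=> x => _.
by rewrite (near h1 x)// (near h3 x)//= (near h2 x)// (near h4 x)//= addrA.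
Unshelve. all: by end_near. Qed.

Let addC : commutative Lspace_add.
Proof.
move=> u v; apply/Lspace_eqP; have := addE u v; have := addE v u.
by apply: filterS2 => x /(_ I) /= e1 /(_ I) /= e2 _; rewrite e1 e2 addrC.
Qed.

Let add0 : left_id Lspace_zero Lspace_add.
Proof.
move=> u; apply/Lspace_eqP; have := addE Lspace_zero u; have := zeroE.
by apply: filterS2 => x /(_ I) /= e1 /(_ I) /= e2 _; rewrite e2 e1 add0r.
Qed.

Let addN : left_inverse Lspace_zero Lspace_opp Lspace_add.
Proof.
move=> u; apply/Lspace_eqP.
have := addE (Lspace_opp u) u; have := scaleE (-1) u; have := zeroE.
apply: filterS3 => x /(_ I) /= e1 /(_ I) /= e2 /(_ I) /= e3 _.
by rewrite e1 e3 e2 mulN1r addNr.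
Qed.

HB.instance Definition _ := GRing.isZmodule.Build Lp addA addC add0 addN.

Let scaleA a b u : Lspace_scale a (Lspace_scale b u) = Lspace_scale (a * b) u.
Proof.
apply/Lspace_eqP; have := scaleE a (Lspace_scale b u).
have := scaleE b u; have := scaleE (a * b) u.
apply: filterS3 => x /(_ I) /= e1 /(_ I) /= e2 /(_ I) /= e3 _.
by rewrite e3 e2 e1 mulrA.
Qed.

Let scale1 : left_id 1 Lspace_scale.
Proof.
move=> u; apply/Lspace_eqP; have := scaleE 1 u.
by apply: filterS => x /(_ I) /= e1 _; rewrite e1 mul1r.
Qed.

Let scaleDr : right_distributive Lspace_scale +%R.
Proof.
move=> a u v; apply/Lspace_eqP.
have h1 := scaleE a (Lspace_add u v); have h2 := addE u v.
have h3 := addE (Lspace_scale a u) (Lspace_scale a v).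
have h4 := scaleE a u; have h5 := scaleE a v.
near=> x => _; rewrite (near h1 x)//= (near h2 x)//= (near h3 x)//=.
by rewrite (near h4 x)// (near h5 x)//= mulrDr.
Unshelve. all: by end_near. Qed.

Let scaleDl u : {morph Lspace_scale^~ u : a b / a + b}.
Proof.
move=> a b; apply/Lspace_eqP.
have h1 := scaleE (a + b) u; have h2 := scaleE a u; have h3 := scaleE b u.
have h4 := addE (Lspace_scale a u) (Lspace_scale b u).
near=> x => _; rewrite (near h1 x)//= (near h4 x)//=.
by rewrite (near h2 x)// (near h3 x)//= mulrDl.
Unshelve. all: by end_near. Qed.

HB.instance Definition _ :=
  GRing.Zmodule_isLmodule.Build R Lp scaleA scale1 scaleDr scaleDl.

Lemma LspaceD (u v : Lp) : ((u + v : Lp) : T -> R) = (u \+ v) %[ae mu].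
Proof. exact: addE. Qed.

Lemma LspaceZ a (u : Lp) : ((a *: u : Lp) : T -> R) = (fun x => a * u x) %[ae mu].
Proof. exact: scaleE. Qed.

Lemma Lspace0 : ((0 : Lp) : T -> R) = cst 0 %[ae mu].
Proof. exact: zeroE. Qed.

Definition Lspace_norm (u : Lp) : R := fine 'N[mu]_p[EFin \o u].

Let normE (u : Lp) : (Lspace_norm u)%:E = 'N[mu]_p[EFin \o u]%E.
Proof.
rewrite /Lspace_norm fineK// fin_numElt (lt_le_trans ltNy0) ?Lnorm_ge0//=.
by have /andP[_] := Lspace_Lfun u; rewrite inE.
Qed.

Let mLspace (u : Lp) : measurable_fun [set: T] (u : T -> R).
Proof. exact: Lfun_measurable (Lspace_Lfun u). Qed.

Let normD u v : Lspace_norm (u + v) <= Lspace_norm u + Lspace_norm v.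
Proof.
rewrite -lee_fin EFinD !normE (ae_eq_Lnorm (mLspace _) _ (LspaceD u v)).
  exact: eminkowski.
exact: measurable_funD.
Qed.

Let normZ a u : Lspace_norm (a *: u) = `|a| * Lspace_norm u.
Proof.
apply/EFin_inj; rewrite EFinM !normE (ae_eq_Lnorm (mLspace _) _ (LspaceZ a u)).
  exact: (@LnormZ _ _ _ _ _ p1 (Lfun_Sub p1 (Lspace_Lfun u)) a).
exact: measurable_funM.
Qed.

Let norm0 u : Lspace_norm u = 0 -> u = 0.
Proof.
move=> u0; apply/Lspace_eqP.
have h1 := @fine_Lnormr_eq0 _ _ _ _ _ p1 (Lfun_Sub p1 (Lspace_Lfun u)) u0.
have h2 := Lspace0.
near=> x => _; rewrite (near h2 x)//.
exact: (near h1 x).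
Unshelve. all: by end_near. Qed.

HB.instance Definition _ := Lmodule_isNormed.Build R Lp normD normZ norm0.

Lemma Lspace_normE (u : Lp) : `|u|%:E = 'N[mu]_p[EFin \o u]%E.
Proof. exact: normE. Qed.

End Lspace_normed.

(** Finite products of normed modules, with the sum norm. *)
Section ffun_normed.
Context (R : realType) (I : finType) (V : normedModType R).

Local Notation W := {ffun I -> V}.

Let nrm (u : W) : R := \sum_(i : I) `|u i|.

Let nrmD u v : nrm (u + v) <= nrm u + nrm v.
Proof.
by rewrite /nrm -big_split /=; apply: ler_sum => i _; rewrite ffunE ler_normD.
Qed.

Let nrmZ a u : nrm (a *: u) = `|a| * nrm u.
Proof.
by rewrite /nrm mulr_sumr; apply: eq_bigr => i _; rewrite ffunE normrZ.
Qed.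

Let nrm0 u : nrm u = 0 -> u = 0.
Proof.
move=> /eqP; rewrite psumr_eq0// => /allP u0; apply/ffunP => i.
by rewrite ffunE; apply/eqP; rewrite -normr_eq0; apply/u0/mem_index_enum.
Qed.

HB.instance Definition _ := Lmodule_isNormed.Build R W nrmD nrmZ nrm0.

Lemma ffun_normE (u : W) : `|u| = \sum_(i : I) `|u i|.
Proof. by []. Qed.

End ffun_normed.

Section C0_semigroup.
Context (R : realType) (V : normedModType R).
Implicit Types (T : R -> {linear V -> V}) (D : set V) (A : V -> V).

(** Only the operators [T t] with [0 <= t] are meaningful. For linear maps,
    continuity is boundedness. *)
Definition C0_semigroup T : Prop :=
  [/\ forall t, 0 <= t -> continuous (T t),
      forall u, T 0 u = u,
      forall s t, 0 <= s -> 0 <= t -> forall u, T (s + t) u = T s (T t u)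
    & forall u, {within `[0, +oo[, continuous (fun t => T t u)}].

Definition generator_quotient T (u : V) (h : R) : V := h^-1 *: (T h u - u).

Definition generator_domain T : set V :=
  [set u | cvg (generator_quotient T u h @[h --> 0^'+])].

Definition generator T (u : V) : V :=
  lim (generator_quotient T u h @[h --> 0^'+]).

Definition generates D A T : Prop :=
  [/\ C0_semigroup T, generator_domain T = D
    & forall u, D u -> generator T u = A u].

End C0_semigroup.

Section L1_W11.
Context (R : realType).

Definition unit_itv_measure :=
  mrestr (@lebesgue_measure R) (measurable_itv `[0%R, 1%R]).

HB.instance Definition _ := Measure.on unit_itv_measure.

(** L_1(I) for I = [0,1]: measurable functions on the whole line, identified
    when they agree a.e. on I; values outside I are irrelevant. *)
Definition L1I := LspaceType1 unit_itv_measure.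

(** Test functions: smooth functions with compact support in ]0,1[. *)
Definition test_function (phi : R -> R) : Prop :=
  [/\ forall n x, derivable phi^`(n)%classic x 1,
      compact (closure [set x | phi x != 0])
    & closure [set x | phi x != 0] `<=` `]0, 1[].

Definition is_weak_derivative (u g : L1I) : Prop :=
  forall phi, test_function phi ->
    \int[unit_itv_measure]_x (u x * phi^`()%classic x) =
    - \int[unit_itv_measure]_x (g x * phi x).

(** The weak derivative, 0 if there is none. *)
Definition weak_derivative (u : L1I) : L1I :=
  xget 0 [set g | is_weak_derivative u g].

Definition W11 : set L1I := [set u | exists g, is_weak_derivative u g].

(** A representative of the class [u] that is continuous on I, if there is
    one; its values on I, endpoints included, are then determined by [u]. *)
Definition continuous_repr (u : L1I) : R -> R :=
  xget (u : R -> R) [set f : R -> R |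
    {within `[0, 1], continuous f} /\ f = u %[ae unit_itv_measure]].

End L1_W11.

Arguments unit_itv_measure : clear implicits.

Section transport_operator.
Context (R : realType) (m : nat).

Definition L1Im := {ffun 'I_m -> L1I R}.

Implicit Types u : L1Im.

Definition W11m : set L1Im := [set u | forall i, W11 (u i)].

(** The value u(x), x in I, of a vector function u in W^1_1(I)^m. *)
Definition point_value u (x : R) : 'cV[R]_m :=
  \col_i continuous_repr (u i) x.

Definition transport_domain (K : 'M[R]_m) : set L1Im :=
  [set u | W11m u /\ point_value u 0 = K *m point_value u 1].

Definition transport (c : 'I_m -> R) u : L1Im :=
  [ffun i => - c i *: weak_derivative (u i)].

Definition nonneg_L1 u : Prop :=
  forall i, \forall x \ae unit_itv_measure R, 0 <= u i x.

Definition positive_semigroup (T : R -> {linear L1Im -> L1Im}) : Prop :=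
  forall t, 0 <= t -> forall u, nonneg_L1 u -> nonneg_L1 (T t u).

End transport_operator.

(* Main.v *)
From HB Require Import structures.
Require Import Defs.
From mathcomp Require Import all_boot all_order all_algebra.
From mathcomp Require Import all_classical all_reals all_analysis.
From mathcomp Require Import lra ring measurable_realfun.
Import Order.TTheory GRing.Theory Num.Theory.
Import numFieldNormedType.Exports.
Local Open Scope classical_set_scope.
Local Open Scope ring_scope.

(** Along the characteristics, the component [u_j] travels to the right at speed
    [c_j]; it reaches the endpoint 1 after the delay [1/c_j] and re-enters at 0,
    distributed over the components by [K]. So a state [u] is encoded by its
    outflow, the family [y_j(s)] of the values that leave [u_j] through the
    endpoint 1 at time [s >= 0]. The outflow is the datum [u_j (1 - c_j s)] as long
    as [s <= 1/c_j], and then solves the delay equation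
      [y_j(s) = sum_k K_jk y_k(s - 1/c_j)],  [s > 1/c_j].
    All delays are at least some [d > 0], hence the equation is solved step by
    step, in a unique way, and the L^1 norm of [y] on [[0, S]] is bounded by a
    multiple of the norm of [u] ([delay_sol_unique], [L1norm_delay_sol_bounded]).

    The semigroup is the translation of outflows: [T(t) u] is the state with
    outflow [y(. + t)]. The semigroup law is the uniqueness for the delay
    equation, and strong continuity is continuity of translations in L^1
    ([L1norm_translation_cvg]).

    Its generator is differentiation of outflows. The quotient [(T(h)u - u)/h]
    tends to [g] exactly when the outflow of [u] is a constant plus the primitive
    of the outflow of [g] on the whole half-line ([has_outflow_deriv]). One
    direction is the convergence of the averages of an L^1 function to it
    ([L1norm_average]); the other integrates the quotient and applies Lebesgue's
    differentiation theorem. It remains to compare this condition with the domain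
    of the operator ([has_outflow_deriv_domain], [domain_has_outflow_deriv]): on
    [[0, 1/c_j]] it says that [u_j] is a primitive of [- g_j / c_j], and given this,
    the delay equation propagates it to all times if and only if there is no jump
    at time [1/c_j], that is, [u_j(0) = sum_k K_jk u_k(1)]. Functions with a weak
    derivative are primitives by the lemma of du Bois-Reymond
    ([weak_derivativeP]), for which smooth compactly supported functions are built
    from [exp (- 1/x)].

    Every semigroup generated by the operator is this one, by
    [semigroup_unique]. If [K >= 0], the delay equation preserves nonnegativity of
    outflows. Conversely, start with the constant 1 in the component [j] and 0
    elsewhere: for short times, what has entered the component [i] through 0 is
    [K_ij], so that positivity forces [K_ij >= 0]. *)

(** * Affine changes of variable for the Lebesgue measure *)

Section affine.
Context {R : realType}.
Local Notation mu := (@lebesgue_measure R).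
Implicit Types (f g : R -> R) (a b p q r s t h : R).

Lemma measurable_affine a b : measurable_fun setT (fun x : R => a * x + b).
Proof. by apply: measurable_funD => //; exact: measurable_funM. Qed.

(** Stated as a measure so that uniqueness of the Lebesgue measure applies to it. *)
Definition affine_pushforward a b : {measure set (measurableTypeR R) -> \bar R}.
Proof.
refine (pushforward mu ((fun x => a * x + b) : R -> measurableTypeR R)
  : {measure set _ -> \bar R}).
exact: measurable_affine.
Defined.

(** Both sides are measures of [A] that agree on half-open intervals. *)
Lemma lebesgue_measure_affine a b (A : set R) : a != 0 -> measurable A ->
  mu A = (`|a|%:E * mu ((fun x : R => (a * x + b)%R) @^-1` A))%E.
Proof.
move=> a0 mA.
have a1 : 0 < `|a| by rewrite normr_gt0.
pose nn : {nonneg R} := NngNum (ltW a1).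
transitivity (mscale nn (affine_pushforward a b) A); last by [].
apply: lebesgue_measure_unique => //.
move=> _ [[p q]] _ <- /=; rewrite /mscale/= /pushforward.
have [a_gt0|a_lt0] : (0 < a) + (a < 0).
  by case: (ltgtP 0 a) => H; [left|right|move: a0; rewrite -H eqxx].
- rewrite [X in (_ * mu X)%E](_ : _ = `](p - b) / a, (q - b) / a]%classic); last first.
    apply/seteqP; split=> x /=; rewrite !in_itv/= ltr_pdivrMr// ler_pdivlMr//.
      by case/andP=> h1 h2; apply/andP; split; lra.
    by case/andP=> h1 h2; apply/andP; split; lra.
  rewrite !lebesgue_measure_itv/= !lte_fin ltr_pM2r ?invr_gt0// ltrD2r.
  case: ifPn => _; last by rewrite mule0.
  rewrite gtr0_norm// -EFinD -EFinB -EFinM; congr EFin; field; lra.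
- rewrite [X in (_ * mu X)%E](_ : _ = `[(q - b) / a, (p - b) / a[%classic); last first.
    apply/seteqP; split=> x /=; rewrite !in_itv/= ltr_ndivlMr// ler_ndivrMr//.
      by case/andP=> h1 h2; apply/andP; split; lra.
    by case/andP=> h1 h2; apply/andP; split; lra.
  rewrite !lebesgue_measure_itv/= !lte_fin ltr_nM2r ?invr_lt0// ltrD2r.
  case: ifPn => _; last by rewrite mule0.
  rewrite ltr0_norm// -EFinD -EFinB -EFinM; congr EFin; field; lra.
Qed.

Lemma ge0_integral_affine a b (D : set R) (f : R -> \bar R) : a != 0 -> measurable D ->
  measurable_fun D f -> (forall x, D x -> 0 <= f x)%E ->
  (\int[mu]_(x in D) f x =
   `|a|%:E * \int[mu]_(x in (fun x : R => (a * x + b)%R) @^-1` D) f (a * x + b)%R)%E.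
Proof.
move=> a0 mD mf f0.
have a1 : 0 < `|a| by rewrite normr_gt0.
pose nn : {nonneg R} := NngNum (ltW a1).
pose phi := ((fun x => (a * x + b)%R) : R -> measurableTypeR R).
have mphi : measurable_fun setT phi by exact: measurable_affine.
have := @ge0_integral_pushforward _ _ (measurableTypeR R) (measurableTypeR R) R phi mphi mu D f mD mf.
rewrite /= => <-; last by move=> y; rewrite inE => /f0.
rewrite -(@ge0_integral_mscale _ _ _ (affine_pushforward a b) D mD nn)//.
by apply: eq_measure_integral => A mA _ /=; rewrite /mscale/= (lebesgue_measure_affine a b).
Qed.

End affine.

(** * Almost everywhere statements on the line *)

(** Makes the filter lemmas apply to almost everywhere statements on the line. *)
#[local] Instance ae_lebesgue_filter (R : realType) :
  Filter (nbhs (almost_everywhere (@lebesgue_measure R))).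
Proof. exact: (ae_filter_ringOfSetsType (@lebesgue_measure R)). Qed.

Section almost_everywhere.
Context {R : realType}.
Local Notation mu := (@lebesgue_measure R).
Implicit Types (P Q : R -> Prop) (a b : R).

Lemma ae_neq (r : R) : {ae mu, forall x, x <> r}.
Proof.
exists [set r]; split=> //; first exact: lebesgue_measure_set1.
by move=> x /= /contrapT.
Qed.

Lemma ae_conj (P Q : R -> Prop) : {ae mu, forall x, P x} -> {ae mu, forall x, Q x} ->
  {ae mu, forall x, P x /\ Q x}.
Proof. by move=> HP HQ; apply: filterS2 HP HQ. Qed.

Lemma ae_affine (P : R -> Prop) (a b : R) : a != 0 ->
  {ae mu, forall x, P x} -> {ae mu, forall x, P (a * x + b)}.
Proof.
move=> a0 [A [mA A0 PA]]; exists ((fun x => a * x + b) @^-1` A); split.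
- rewrite -[X in measurable X]setTI; exact: (measurable_affine a b).
- have := lebesgue_measure_affine a b A a0 mA; rewrite A0 => /esym/eqP.
  by rewrite mule_eq0 eqe normr_eq0 (negbTE a0)/= => /eqP.
- by move=> x /= nP; apply: PA.
Qed.

(** An interval of positive length is not negligible. *)
Lemma ae_exists (P : R -> Prop) a b : a < b -> {ae mu, forall x, P x} ->
  exists2 x, a <= x <= b & P x.
Proof.
move=> ab [A [mA A0 PA]]; apply: contrapT => H.
have sub : `[a, b] `<=` A.
  by move=> x xab; apply: PA => /= Px; apply: H; exists x => //; move: xab; rewrite /= in_itv.
have : (mu `[a, b]%classic <= mu A)%E by apply: le_measure; rewrite ?inE.
by rewrite A0 lebesgue_measure_itv/= lte_fin ab -EFinB lee_fin; lra.
Qed.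

(** Countably many exceptional sets, one for each bounded part of the half-line. *)
Lemma ae_nonneg_bounded (P : R -> Prop) :
  (forall n : nat, {ae mu, forall s, 0 <= s <= n%:R -> P s}) ->
  {ae mu, forall s, 0 <= s -> P s}.
Proof.
move=> /ae_foralln; apply: filterS => s H s0.
by apply: (H (Num.truncn s).+1); rewrite s0 ltW// truncnS_gt.
Qed.

End almost_everywhere.

(** * The L^1 norm on an interval *)

Section L1norm.
Context {R : realType}.
Local Notation mu := (@lebesgue_measure R).
Implicit Types (f g : R -> R) (a b p q r s t h k l : R).

(** Valued in the extended reals, so that the estimates need measurability only. *)
Definition L1norm a b f : \bar R := (\int[mu]_(x in `[a, b]) `|f x|%:E)%E.

Lemma measurable_normEFin (D : set R) f : measurable_fun D f ->
  measurable_fun D (fun x => `|f x|%:E).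
Proof. by move=> mf; apply/measurable_EFinP; exact: measurableT_comp. Qed.

Lemma L1norm_ge0 a b f : (0 <= L1norm a b f)%E.
Proof. by apply: integral_ge0 => x _; rewrite lee_fin. Qed.

Lemma L1norm_comp_affine a b p q k l f : measurable_fun setT f -> k != 0 ->
  (fun x : R => k * x + l) @^-1` `[p, q] = `[a, b]%classic ->
  L1norm p q f = (`|k|%:E * L1norm a b (fun x => f (k * x + l)%R))%E.
Proof.
move=> mf k0 abpq; rewrite /L1norm (@ge0_integral_affine _ k l)//; first by rewrite abpq.
apply: measurable_normEFin; exact: measurable_funTS.
Qed.

Lemma L1norm_shift a b h f : measurable_fun setT f ->
  L1norm a b (fun s => f (s + h)) = L1norm (a + h) (b + h) f.
Proof.
move=> mf; rewrite (@L1norm_comp_affine a b (a + h) (b + h) 1 h)//.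
- rewrite normr1 mul1e; congr L1norm; apply/funext => x; by rewrite mul1r.
- apply/seteqP; split=> x /=; rewrite !in_itv/= => /andP[? ?]; apply/andP; split; lra.
Qed.

Lemma L1norm_reflect a b k l f : measurable_fun setT f -> 0 < k ->
  L1norm (l - k * b) (l - k * a) f = (k%:E * L1norm a b (fun x => f (l - k * x)%R))%E.
Proof.
move=> mf k0; rewrite (@L1norm_comp_affine a b (l - k * b) (l - k * a) (- k) l)//.
- rewrite normrN gtr0_norm//; congr (_ * L1norm _ _ _)%E; apply/funext => x.
  by congr f; lra.
- by rewrite oppr_eq0 gt_eqF.
- apply/seteqP; split=> x /=; rewrite !in_itv/= => /andP[h1 h2]; apply/andP; split.
  + by rewrite -(ler_pM2l k0); lra.
  + by rewrite -(ler_pM2l k0); lra.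
  + by move: h2; rewrite -(ler_pM2l k0); lra.
  + by move: h1; rewrite -(ler_pM2l k0); lra.
Qed.

Lemma le_L1norm a b f g : measurable_fun setT f -> measurable_fun setT g ->
  (forall x, a <= x <= b -> `|f x| <= `|g x|) -> (L1norm a b f <= L1norm a b g)%E.
Proof.
move=> mf mg fg; by apply: ge0_le_integral => //=; apply: measurable_normEFin; exact: measurable_funTS.
Qed.

Lemma eq_L1norm a b f g :
  (forall x, a <= x <= b -> f x = g x) -> L1norm a b f = L1norm a b g.
Proof.
by move=> fg; apply: eq_integral => x; rewrite inE/= in_itv/= => /fg ->.
Qed.

Lemma ae_eq_L1norm a b f g : measurable_fun setT f -> measurable_fun setT g ->
  {ae mu, forall x, a <= x <= b -> f x = g x} -> L1norm a b f = L1norm a b g.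
Proof.
move=> mf mg fg.
have mE (k : R -> R) : measurable_fun setT k -> measurable_fun `[a, b] (fun x => `|k x|%:E).
  by move=> mk; apply: measurable_normEFin; exact: measurable_funTS.
apply: ae_eq_integral => //=; [exact: mE|exact: mE|].
by apply: filterS fg => x /= h; rewrite in_itv/= => /h ->.
Qed.

Lemma L1normD a b f g : measurable_fun setT f -> measurable_fun setT g ->
  (L1norm a b (fun x => f x + g x)%R <= L1norm a b f + L1norm a b g)%E.
Proof.
move=> mf mg; rewrite -ge0_integralD//=.
- apply: ge0_le_integral => //=.
  + by apply: measurable_normEFin; apply: measurable_funTS; exact: measurable_funD.
  + by apply: emeasurable_funD; apply: measurable_normEFin; apply: measurable_funTS.
  + by move=> x _; rewrite -EFinD lee_fin ler_normD.
- by apply: measurable_normEFin; exact: measurable_funTS.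
- by apply: measurable_normEFin; exact: measurable_funTS.
Qed.

Lemma L1normN a b f : L1norm a b (fun x => - f x) = L1norm a b f.
Proof. by apply: eq_integral => x _; rewrite normrN. Qed.

Lemma L1normC a b f g : L1norm a b (fun x => f x - g x) = L1norm a b (fun x => g x - f x).
Proof. by apply: eq_integral => x _; rewrite distrC. Qed.

Lemma L1norm_triangle a b f g (k : R -> R) : measurable_fun setT f -> measurable_fun setT g ->
  measurable_fun setT k ->
  (L1norm a b (fun x => f x - k x)%R <=
   L1norm a b (fun x => f x - g x)%R + L1norm a b (fun x => g x - k x)%R)%E.
Proof.
move=> mf mg mk; rewrite (_ : (fun x => f x - k x) = (fun x => (f x - g x) + (g x - k x))).
  by apply: L1normD; exact: measurable_funB.
by apply/funext => x; ring.
Qed.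

Lemma L1normZ a b k f : measurable_fun setT f ->
  L1norm a b (fun x => k * f x) = (`|k|%:E * L1norm a b f)%E.
Proof.
move=> mf; rewrite /L1norm -ge0_integralZl//=.
- by apply: eq_integral => x _; rewrite normrM.
- by apply: measurable_normEFin; exact: measurable_funTS.
Qed.

Lemma L1norm_sum a b (I : Type) (r : seq I) (F : I -> R -> R) :
  (forall i, measurable_fun setT (F i)) ->
  (L1norm a b (fun x => \sum_(i <- r) F i x)%R <= \sum_(i <- r) L1norm a b (F i))%E.
Proof.
move=> mF; elim: r => [|i r IH].
  rewrite big_nil /L1norm integral0_eq// => x _.
  by rewrite big_nil normr0.
rewrite big_cons; under eq_fun do rewrite big_cons.
apply: (le_trans (L1normD _ _ _ _ _ _)) => //; last exact: leeD2l.
exact: measurable_sum.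
Qed.

Lemma L1norm_subset a b p q f : measurable_fun setT f -> p <= a -> b <= q ->
  (L1norm a b f <= L1norm p q f)%E.
Proof.
move=> mf pa bq; apply: ge0_subset_integral => //=.
- by apply: measurable_normEFin; exact: measurable_funTS.
- by apply: subset_itv; rewrite bnd_simp.
Qed.

Lemma L1norm_split a b p f : measurable_fun setT f ->
  (L1norm a b f <= L1norm a p f + L1norm p b f)%E.
Proof.
move=> mf.
apply: (@le_trans _ _ (\int[mu]_(x in `[a, p] `|` `]p, b]) `|f x|%:E)%E).
  apply: ge0_subset_integral => //=.
  - exact: measurableU.
  - by apply: measurable_normEFin; exact: measurable_funTS.
  - move=> x /=; rewrite !in_itv/= => /andP[ax xb].
    by have [xp|xp] := leP x p; [left|right]; apply/andP.
rewrite ge0_integral_setU//=.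
- apply: leeD2l; apply: ge0_subset_integral => //=.
  + by apply: measurable_normEFin; exact: measurable_funTS.
  + by apply: subset_itvr; rewrite bnd_simp.
- by apply: measurable_normEFin; exact: measurable_funTS.
- apply/disj_setPS => x /=; rewrite !in_itv/= => -[/andP[_ h] /andP[h' _]].
  by rewrite ltNge h in h'.
Qed.

Lemma L1norm_eq0P a b f : measurable_fun setT f ->
  L1norm a b f = 0%E <-> {ae mu, forall x, a <= x <= b -> f x = 0}.
Proof.
move=> mf; have mfE : measurable_fun `[a, b] (EFin \o f).
  by apply/measurable_EFinP; exact: measurable_funTS.
have := @ae_eq_integral_abs _ _ _ mu `[a, b]%classic _ (EFin \o f) mfE.
rewrite /L1norm/= => -[//|h1 h2]; split => H.
  have := h1 H; apply: filterS => x /=; rewrite in_itv/= => h /h.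
  by move=> [].
by apply: h2; apply: filterS H => x /=; rewrite in_itv/= => h /h ->.
Qed.

Lemma L1norm_integrable a b f : measurable_fun setT f ->
  (L1norm a b f < +oo)%E <-> mu.-integrable `[a, b] (EFin \o f).
Proof.
move=> mf; split=> [H|/integrableP[]//].
by apply/integrableP; split => //; apply/measurable_EFinP; exact: measurable_funTS.
Qed.

Lemma le_normr_Rintegral_L1norm a b f : mu.-integrable `[a, b] (EFin \o f) ->
  (`|(\int[mu]_(x in `[a, b]) f x)%R|%:E <= L1norm a b f)%E.
Proof.
move=> If; rewrite EFin_normr_Rintegral//.
exact: (le_abse_integral _ _ (measurable_int _ If)).
Qed.

Lemma L1norm_le_cst a b k f : measurable_fun setT f -> a <= b ->
  (forall x, a <= x <= b -> `|f x| <= k) -> (L1norm a b f <= (k * (b - a))%:E)%E.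
Proof.
move=> mf ab fk.
apply: (@le_trans _ _ (\int[mu]_(x in `[a, b]) (cst k%:E x))%E).
  apply: ge0_le_integral => //=.
  by apply: measurable_normEFin; exact: measurable_funTS.
rewrite integral_cst//= lebesgue_measure_itv/= lte_fin.
have [ab'|ba] := ltP a b; first by rewrite -EFinB -EFinM.
by rewrite mule0 (_ : b - a = 0) ?mulr0//; lra.
Qed.

End L1norm.

(** * Translations and iterated integrals in L^1 *)

Section translation.
Context {R : realType}.
Local Notation mu := (@lebesgue_measure R).
Implicit Types (f g : R -> R) (a b p q r s t h k l : R).

Lemma measurable_shift f h : measurable_fun setT f ->
  measurable_fun setT (fun s => f (s + h)).
Proof. by move=> mf; apply: measurableT_comp => //; exact: measurable_funD. Qed.

(** Heine's theorem, from compactness of [[0, S]]: the pairs [(s, h)] near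
    [(s0, 0)] satisfy the estimate by continuity. *)
Lemma continuous_translation_uniform g S e : continuous g -> 0 < e ->
  exists2 d, 0 < d & forall h, 0 <= h <= d -> forall s, 0 <= s <= S ->
    `|g (s + h) - g s| <= e.
Proof.
move=> cg e0.
have /compact_near_coveringP cS : compact (`[0, S]%classic : set R) by exact: segment_compact.
have := cS R (nbhs (0 : R)) (fun h s => `|g (s + h) - g s| <= e) _.
move=> /(_ _)[] => // [s _|d /= d0 dP].
  have c1 : (fun sh : R * R => g (sh.1 + sh.2) - g sh.1) @ (s, 0 : R) --> g (s + 0) - g s.
    apply: cvgB.
      apply: (@cvg_comp _ _ _ (fun sh : R * R => sh.1 + sh.2) g); last exact: cg.
      apply: cvgD; [exact: cvg_fst|exact: cvg_snd].
    apply: (@cvg_comp _ _ _ (fun sh : R * R => sh.1) g); last exact: cg.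
    exact: cvg_fst.
  rewrite addr0 subrr in c1.
  have /cvgr0Pnorm_le/(_ e e0) := c1; by apply: filterS.
exists (d / 2); first by rewrite divr_gt0.
move=> h /andP[h0 hd] s sS; apply: dP => //=.
by rewrite sub0r normrN ger0_norm//; lra.
Qed.

(** Approximate [f] in L^1 by a continuous function, for which the translates
    converge uniformly; translating the error does not change its norm, except that
    the interval has to be enlarged, by 1 here. *)
Lemma L1norm_translation_cvg f S e : measurable_fun setT f -> 0 <= S ->
  (L1norm 0 (S + 1) f < +oo)%E -> 0 < e ->
  exists2 d, 0 < d & forall h, 0 <= h <= d ->
    (L1norm 0 S (fun s => f (s + h) - f s)%R <= e%:E)%E.
Proof.
move=> mf S0 If e0.
have If' : mu.-integrable `[0, S + 1] (EFin \o f) by exact/L1norm_integrable.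
have muS : (mu `[0%R, (S + 1)%R]%classic < +oo)%E.
  by rewrite lebesgue_measure_itv/=; case: ifPn => //; rewrite ltry.
have [g_ [cg Ig gf]] := approximation_continuous_integrable (measurable_itv _) muS If'.
(* The error is split evenly between the two approximations and the translation
   of the continuous function. *)
have e3 : 0 < e / 3 by rewrite divr_gt0.
have [n gn] : exists n, (L1norm 0 (S + 1) (fun x => f x - g_ n x)%R < (e / 3)%:E)%E.
  move/fine_cvgP : gf => [gfin /(cvgr_lt 0)/(_ _ e3) glt].
  have [n [/= gfin_n glt_n]] := filter_ex (filterI gfin glt).
  by exists n; rewrite /L1norm -(fineK gfin_n) lte_fin.
set g := g_ n in gn.
have mg : measurable_fun setT g by apply: continuous_measurable_fun; exact: cg.
have eS : 0 < e / 3 / (S + 1) by rewrite divr_gt0//; lra.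
have [d d0 dP] := continuous_translation_uniform g S _ (cg n) eS.
exists (Num.min d 1); first by rewrite lt_min d0 ltr01.
move=> h /andP[h0]; rewrite le_min => /andP[hd h1].
have mfh := measurable_shift f h mf.
have mgh := measurable_shift g h mg.
apply: (le_trans (L1norm_triangle _ _ _ (fun s => g (s + h)) _ _ _ _)) => //.
have -> : e%:E = ((e / 3)%:E + ((e / 3)%:E + (e / 3)%:E))%E by rewrite -!EFinD; congr EFin; field.
apply: leeD.
  apply: (@le_trans _ _ (L1norm 0 (S + 1) (fun x => f x - g x))); last exact: ltW.
  rewrite (L1norm_shift 0 S h (fun x => f x - g x)); last exact: measurable_funB.
  by apply: L1norm_subset; [exact: measurable_funB|lra|lra].
apply: (le_trans (L1norm_triangle _ _ _ g _ _ _ _)) => //.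
apply: leeD.
  apply: (le_trans (L1norm_le_cst 0 S (e / 3 / (S + 1)) _ _ S0 _)).
  - exact: measurable_funB.
  - by move=> x xS; apply: dP => //; rewrite h0.
  - rewrite lee_fin subr0 mulrAC ler_pdivrMr; [nra|lra].
apply: (@le_trans _ _ (L1norm 0 (S + 1) (fun x => f x - g x))); last exact: ltW.
rewrite L1normC; apply: L1norm_subset; [exact: measurable_funB|lra|lra].
Qed.

(** Tonelli's theorem for the restriction of [F] to the product of [A] and [B]. *)
Lemma fubini_tonelli_itv (A B : set R) (F : R -> R -> \bar R) :
  measurable A -> measurable B ->
  measurable_fun setT (fun z : R * R => F z.1 z.2) ->
  (forall x y, 0 <= F x y)%E ->
  (\int[mu]_(x in A) \int[mu]_(y in B) F x y = \int[mu]_(y in B) \int[mu]_(x in A) F x y)%E.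
Proof.
move=> mA mB mF F0.
pose G := (fun z : R * R => F z.1 z.2) \_ (A `*` B).
have mG : measurable_fun setT G.
  apply/(measurable_restrictT _ _).1; first exact: measurableX.
  exact: measurable_funTS.
have G0 z : (0 <= G z)%E by apply: erestrict_ge0 => x _; exact: F0.
transitivity (\int[mu]_x \int[mu]_y G (x, y))%E.
  rewrite integral_mkcond; apply: eq_integral => x _; rewrite patchE.
  case: ifPn => xA.
    rewrite integral_mkcond; apply: eq_integral => y _; rewrite /G !patchE in_setX/= xA/=.
    by case: ifPn.
  rewrite integral0_eq// => y _; rewrite /G patchE in_setX/= (negbTE xA)//.
transitivity (\int[mu]_y \int[mu]_x G (x, y))%E.
  exact: (@fubini_tonelli _ _ (measurableTypeR R) (measurableTypeR R) R mu mu G mG G0).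
rewrite [RHS]integral_mkcond; apply: eq_integral => y _; rewrite patchE.
case: ifPn => yB.
  rewrite [RHS]integral_mkcond; apply: eq_integral => x _; rewrite /G !patchE in_setX/= yB andbT.
  by case: ifPn.
rewrite integral0_eq// => x _; rewrite /G patchE in_setX/= (negbTE yB) andbF//.
Qed.

Lemma integrable_affine a b p q k l f : measurable_fun setT f -> k != 0 ->
  (fun x : R => k * x + l) @^-1` `[p, q] = `[a, b]%classic ->
  mu.-integrable `[p, q] (EFin \o f) ->
  mu.-integrable `[a, b] (EFin \o (fun x => f (k * x + l))).
Proof.
move=> mf k0 abpq If; apply/L1norm_integrable.
  exact: (measurableT_comp mf (measurable_affine k l)).
move/L1norm_integrable : If => /(_ mf).
rewrite (L1norm_comp_affine a b p q k l)//.
have k1 : 0 < `|k| by rewrite normr_gt0.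
case: (L1norm a b _) => [r| |] //.
- by move=> _; exact: ltry.
- by rewrite gt0_muley// lte_fin.
Qed.

Lemma Rintegral_affine a b p q k l f : measurable_fun setT f -> k != 0 ->
  (fun x : R => k * x + l) @^-1` `[p, q] = `[a, b]%classic ->
  mu.-integrable `[p, q] (EFin \o f) ->
  \int[mu]_(x in `[p, q]) f x = `|k| * \int[mu]_(x in `[a, b]) f (k * x + l).
Proof.
move=> mf k0 abpq If.
have Ig := integrable_affine a b p q k l f mf k0 abpq If.
rewrite /Rintegral -[LHS]/(fine _) -[`|k|]/(fine `|k|%:E) -fineM//; last first.
  exact: integrable_fin_num.
congr fine; rewrite integralE [in RHS]integralE.
have mE : measurable_fun `[p, q] (EFin \o f).
  by apply/measurable_EFinP; exact: measurable_funTS.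
rewrite muleBr//; last first.
  exact: integrable_add_def.
rewrite (@ge0_integral_affine _ k l _ (EFin \o f)^\+)%E//; last exact: measurable_funepos.
rewrite (@ge0_integral_affine _ k l _ (EFin \o f)^\-)%E//; last exact: measurable_funeneg.
rewrite abpq.
by congr (_ * _ - _ * _)%E; apply: eq_integral => x _; rewrite ?funeposE ?funenegE.
Qed.

End translation.

(** * Primitives of functions integrable on bounded parts of the half-line *)

Section primitive.
Context {R : realType}.
Local Notation mu := (@lebesgue_measure R).
Implicit Types (f g : R -> R) (a b p q r s t h k l : R).

Lemma Rintegral_shift a b h f : measurable_fun setT f ->
  mu.-integrable `[a + h, b + h] (EFin \o f) ->
  \int[mu]_(x in `[a, b]) f (x + h) = \int[mu]_(x in `[a + h, b + h]) f x.
Proof.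
move=> mf If; rewrite (Rintegral_affine a b (a + h) (b + h) 1 h)//.
  by rewrite normr1 mul1r; apply: eq_Rintegral => x _; rewrite mul1r.
by apply/seteqP; split=> x /=; rewrite !in_itv/= => /andP[? ?]; apply/andP; split; lra.
Qed.

Lemma Rintegral_reflect a b k l f : measurable_fun setT f -> 0 < k ->
  mu.-integrable `[l - k * b, l - k * a] (EFin \o f) ->
  k * \int[mu]_(x in `[a, b]) f (l - k * x) = \int[mu]_(x in `[l - k * b, l - k * a]) f x.
Proof.
move=> mf k0 If; rewrite (Rintegral_affine a b (l - k * b) (l - k * a) (- k) l)//.
- by rewrite normrN gtr0_norm//; congr (_ * _); apply: eq_Rintegral => x _; congr f; lra.
- by rewrite oppr_eq0 gt_eqF.
- apply/seteqP; split=> x /=; rewrite !in_itv/= => /andP[h1 h2]; apply/andP; split.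
  + by rewrite -(ler_pM2l k0); lra.
  + by rewrite -(ler_pM2l k0); lra.
  + by move: h2; rewrite -(ler_pM2l k0); lra.
  + by move: h1; rewrite -(ler_pM2l k0); lra.
Qed.

(** Functions on the line of which only the values on the half-line matter. *)
Definition locint f := measurable_fun setT f /\ forall S, (L1norm 0 S f < +oo)%E.

(** Constant, equal to 0, on the negative numbers, where the interval is empty. *)
Definition prim f s := \int[mu]_(t in `[0, s]) f t.

Lemma locint_integrable f a b : locint f -> 0 <= a ->
  mu.-integrable `[a, b] (EFin \o f).
Proof.
move=> [mf fS] a0; apply/L1norm_integrable => //.
by apply: le_lt_trans (fS b); exact: L1norm_subset.
Qed.

Lemma locintD f g : locint f -> locint g -> locint (fun x => f x + g x).
Proof.
move=> [mf fS] [mg gS]; split; first exact: measurable_funD.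
move=> S; apply: (le_lt_trans (L1normD _ _ _ _ mf mg)).
by rewrite lte_add_pinfty.
Qed.

Lemma locintZ f k : locint f -> locint (fun x => k * f x).
Proof.
move=> [mf fS]; split; first exact: measurable_funM.
by move=> S; rewrite L1normZ// lte_mul_pinfty// lee_fin.
Qed.

Lemma locintN f : locint f -> locint (fun x => - f x).
Proof. by move=> /(locintZ _ (-1)); under eq_fun do rewrite mulN1r. Qed.

Lemma locintB f g : locint f -> locint g -> locint (fun x => f x - g x).
Proof. by move=> lf /locintN; exact: locintD. Qed.

Lemma locint_cst k : locint (fun=> k).
Proof.
split => // S; have [S0|S0] := leP 0 S.
  apply: le_lt_trans (L1norm_le_cst 0 S `|k| _ _ S0 _) _ => //.
  exact: ltry.
rewrite /L1norm set_itv_ge ?integral_set0// bnd_simp -ltNge//.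
Qed.

Lemma locint_sum (I : Type) (r : seq I) (F : I -> R -> R) :
  (forall i, locint (F i)) -> locint (fun x => \sum_(i <- r) F i x).
Proof.
move=> lF; elim: r => [|i r IH].
  by under eq_fun do rewrite big_nil; exact: locint_cst.
by under eq_fun do rewrite big_cons; exact: locintD.
Qed.

Lemma locint_shift f h : 0 <= h -> locint f -> locint (fun x => f (x + h)).
Proof.
move=> h0 [mf fS]; split; first exact: measurable_shift.
move=> S; rewrite L1norm_shift//; apply: le_lt_trans (fS (S + h)).
by apply: L1norm_subset => //; rewrite add0r.
Qed.

Lemma locint_continuous f : continuous f -> locint f.
Proof.
move=> cf; have mf : measurable_fun setT f by exact: continuous_measurable_fun.
split => // S; apply/L1norm_integrable => //.
apply: continuous_compact_integrable; first exact: segment_compact.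
exact: continuous_subspaceT.
Qed.

Lemma continuous_bounded_itv f a b : continuous f ->
  exists2 B : R, 0 <= B & forall x, a <= x <= b -> `|f x| <= B.
Proof.
move=> cf; have [ab|ba] := leP a b; last first.
  by exists 0 => // x /andP[h1 h2]; exfalso; have := le_trans h1 h2; lra.
have cn : {within `[a, b], continuous (fun x => `|f x|)}.
  by apply: continuous_subspaceT => x; apply: cvg_norm; exact: cf.
have [z _ zP] := EVT_max ab cn.
by exists `|f z| => // x xab; apply: zP; rewrite in_itv.
Qed.

Lemma locintM_continuous f w : locint f -> continuous w -> locint (fun x => f x * w x).
Proof.
move=> lf cw; have mw := continuous_measurable_fun cw.
split; first by apply: measurable_funM => //; exact: lf.1.
move=> S; have [B B0 wB] := continuous_bounded_itv w 0 S cw.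
apply: (@le_lt_trans _ _ (L1norm 0 S (fun x => B * f x))); last exact: (locintZ f B lf).2.
apply: le_L1norm.
- by apply: measurable_funM => //; exact: lf.1.
- by apply: measurable_funM => //; exact: lf.1.
- by move=> x /wB xB; rewrite !normrM mulrC ler_wpM2r// [leRHS]ger0_norm.
Qed.

Lemma prim0 f s : s <= 0 -> prim f s = 0.
Proof.
rewrite le_eqVlt => /predU1P[->|s0]; first by rewrite /prim set_itv1 Rintegral_set1.
by rewrite /prim set_itv_ge ?Rintegral_set0// bnd_simp -ltNge.
Qed.

Lemma prim_sub f a b : locint f -> 0 <= a <= b ->
  prim f b - prim f a = \int[mu]_(t in `[a, b]) f t.
Proof.
move=> lf /andP[a0 ab]; rewrite /prim Rintegral_itvB//.
- rewrite Rintegral_itv_obnd_cbnd//.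
  apply: integrableS (locint_integrable f a b lf a0) => //.
  by apply: subset_itvr; rewrite bnd_simp.
- exact: locint_integrable.
Qed.

Lemma eq_prim f g s : (forall x, 0 <= x <= s -> f x = g x) -> prim f s = prim g s.
Proof. by move=> fg; apply: eq_Rintegral => x; rewrite inE/= in_itv/= => /fg. Qed.

Lemma primD f g s : locint f -> locint g ->
  prim (fun x => f x + g x) s = prim f s + prim g s.
Proof. by move=> lf lg; rewrite /prim RintegralD//; exact: locint_integrable. Qed.

Lemma primZ f k s : locint f -> prim (fun x => k * f x) s = k * prim f s.
Proof. by move=> lf; rewrite /prim RintegralZl//; exact: locint_integrable. Qed.

Lemma primB f g s : locint f -> locint g ->
  prim (fun x => f x - g x) s = prim f s - prim g s.
Proof. by move=> lf lg; rewrite /prim RintegralB//; exact: locint_integrable. Qed.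

Lemma prim_sum (I : Type) (r : seq I) (F : I -> R -> R) s :
  (forall i, locint (F i)) ->
  prim (fun x => \sum_(i <- r) F i x) s = \sum_(i <- r) prim (F i) s.
Proof.
move=> lF; elim: r => [|i r IH].
  rewrite big_nil /prim; under eq_Rintegral do rewrite big_nil.
  by rewrite /Rintegral integral0.
rewrite big_cons -IH -primD//; last exact: locint_sum.
by apply: eq_prim => x _; rewrite big_cons.
Qed.

Lemma prim_cst k s : 0 <= s -> prim (fun=> k) s = k * s.
Proof.
move=> s0; rewrite /prim Rintegral_cst//= lebesgue_measure_itv/= lte_fin.
by case: ltgtP s0 => //= [s0 _|<-]; rewrite ?subr0.
Qed.

Lemma prim_eq0 f lo x : (forall y, y < lo -> f y = 0) -> x < lo -> prim f x = 0.
Proof.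
move=> f0 xlo; have [x0|x0] := leP x 0; first exact: prim0.
rewrite (eq_prim f (fun=> 0)); first by rewrite prim_cst ?mul0r// ltW.
by move=> y /andP[_ yx]; apply: f0; exact: le_lt_trans xlo.
Qed.

Lemma prim_constant f hi x : locint f -> (forall y, hi <= y -> f y = 0) ->
  0 <= hi <= x -> prim f x = prim f hi.
Proof.
move=> lf f0 hx; apply/eqP; rewrite -subr_eq0 prim_sub//; apply/eqP.
transitivity (\int[mu]_(t in `[hi, x]) (0 : R)); last by rewrite /Rintegral integral0.
by apply: eq_Rintegral => y; rewrite inE/= in_itv/= => /andP[hy _]; exact: f0.
Qed.

Lemma prim_shift f a s : locint f -> 0 <= a -> 0 <= s ->
  prim (fun x => f (x + a)) s = prim f (s + a) - prim f a.
Proof.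
move=> lf a0 s0; rewrite prim_sub//; last by rewrite a0/=; lra.
rewrite /prim Rintegral_shift ?add0r//; first by case: lf.
exact: locint_integrable.
Qed.

Lemma le_prim_L1norm f s S : locint f -> s <= S -> (`|prim f s|%:E <= L1norm 0 S f)%E.
Proof.
move=> lf sS; apply: (le_trans (le_normr_Rintegral_L1norm _ _ _ _)).
  exact: locint_integrable.
by apply: L1norm_subset => //; case: lf.
Qed.

Lemma ae_eq_prim f g s : measurable_fun setT f -> measurable_fun setT g ->
  {ae mu, forall x, 0 <= x -> f x = g x} -> prim f s = prim g s.
Proof.
move=> mf mg fg; rewrite /prim /Rintegral; congr fine; apply: ae_eq_integral => //=.
- by apply/measurable_EFinP; exact: measurable_funTS.
- by apply/measurable_EFinP; exact: measurable_funTS.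
- by apply: filterS fg => x /= fg; rewrite in_itv/= => /andP[/fg ->].
Qed.

Let restr f := f \_ `[0, +oo[.

Let restrict_integrable f a b : locint f -> mu.-integrable `[a, b] (EFin \o restr f).
Proof.
move=> lf; rewrite /restr -restrict_EFin; apply/integrable_restrict => //=.
apply: integrableS (locint_integrable f 0 b lf (lexx _)) => //=; first exact: measurableI.
by move=> x /= [+ +]; rewrite !in_itv/= ?andbT => h1 h2; move: h1 h2 => /andP[_ ->]; rewrite andbT.
Qed.

Let prim_restrict f a s : a <= 0 -> prim f s = \int[mu]_(t in `[a, s]) restr f t.
Proof.
move=> a0; rewrite /prim /restr -Rintegral_mkcondr; congr Rintegral.
apply/seteqP; split=> x /=; rewrite !in_itv/= andbT.
  by move=> /andP[x0 xs]; split => //; rewrite xs andbT; lra.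
by move=> [/andP[_ ->] ->].
Qed.

(** The function is continued by 0 to the negative numbers, so that 0 becomes an
    interior point of the interval of integration. *)
Lemma prim_continuous f : locint f -> continuous (prim f).
Proof.
move=> lf x; pose N := `|x| + 1.
have xN : - N < x < N by have := ler_norm x; have := ler_norm (- x); rewrite normrN /N; lra.
have N0 : - N <= 0 by have := normr_ge0 x; rewrite /N; lra.
have -> : prim f = (fun s => \int[mu]_(t in `[- N, s]) restr f t).
  by apply/funext => s; exact: prim_restrict.
apply: (@within_continuous_continuous _ _ _ (- N) N); first by lra.
  apply: parameterized_integral_continuous; first by lra.
  exact: restrict_integrable.
by rewrite in_itv.
Qed.

(** Lebesgue's differentiation theorem. *)
Lemma prim_derivative_ae f : locint f ->
  {ae mu, forall x, 0 <= x -> h^-1 * (prim f (x + h) - prim f x) @[h --> 0^'+] --> f x}.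
Proof.
move=> lf.
have lc : locally_integrable setT (restr f).
  split; [|exact: openT|move=> A _ cA].
    apply/(measurable_restrictT _ _).1 => //; apply: measurable_funTS; exact: lf.1.
  have [N [_ AN]] := compact_bounded cA.
  have AN1 : A `<=` `[- (N + 1), N + 1].
    move=> x Ax; have := AN (N + 1) _ x Ax.
    rewrite ltrDl ltr01 => /(_ isT) /=; rewrite ler_norml.
    by rewrite in_itv.
  have /integrableP[mc cfin] := restrict_integrable f (- (N + 1)) (N + 1) lf.
  apply: le_lt_trans cfin; apply: ge0_subset_integral => //=.
  - exact: compact_measurable.
  - by apply: measurable_normEFin; exact/measurable_EFinP.
pose a : itv_bound R := BLeft (-1).
have := @FTC1 _ (restr f) a (fun y => restrict_integrable f (-1) y lf) lc.
apply: filterS => x /= H x0.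
have {H}[|dF F'] := H.
  by rewrite lte_fin; lra.
have FE : (fun y => \int[mu]_(t in [set` Interval a (BRight y)]) restr f t) = prim f.
  by apply/funext => y; rewrite -prim_restrict//; lra.
rewrite FE in dF F'.
have -> : f x = (prim f)^`()%classic x.
  by rewrite F' /restr patchE mem_set//= in_itv/= andbT.
rewrite derive1E; move: dF => /cvg_ex[l dF].
have -> : 'D_1 (prim f) x = l by exact/cvg_lim.
have := cvg_dnbhs_at_right dF; apply: cvg_trans; apply: near_eq_cvg.
by apply: nearW => h /=; rewrite [h *: 1]mulr1 [x + h]addrC.
Qed.

Lemma is_derive_prim f x : locint f -> 0 < x -> {for x, continuous f} ->
  is_derive x 1 (prim f) (f x).
Proof.
move=> lf x0 cf; have xx1 : x < x + 1 by rewrite ltrDl.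
have [d1 d2] : derivable (prim f) x 1 /\ (prim f)^`()%classic x = f x :=
  continuous_FTC1_closed xx1 (locint_integrable f 0 (x + 1) lf (lexx 0)) x0 cf.
by apply: DeriveDef; [exact: d1|rewrite -derive1E; exact: d2].
Qed.

End primitive.

(** * Convergence of averages in L^1 *)

Section average.
Context {R : realType}.
Local Notation mu := (@lebesgue_measure R).
Implicit Types (f g : R -> R) (a b p q r s t h k l : R).

Lemma measurable_integral_section (B : set R) (F : R -> R -> \bar R) :
  measurable B -> measurable_fun setT (fun z : R * R => F z.1 z.2) ->
  (forall x y, 0 <= F x y)%E ->
  measurable_fun setT (fun x => \int[mu]_(y in B) F x y)%E.
Proof.
move=> mB mF F0.
pose G := (fun z : R * R => F z.1 z.2) \_ (setT `*` B).
have mG : measurable_fun setT G.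
  apply/(measurable_restrictT _ _).1; first exact: measurableX.
  exact: measurable_funTS.
have G0 z : (0 <= G z)%E by apply: erestrict_ge0 => x _; exact: F0.
have -> : (fun x => \int[mu]_(y in B) F x y)%E = (fun x => \int[mu]_y G (x, y))%E.
  apply/funext => x; rewrite integral_mkcond; apply: eq_integral => y _.
  by rewrite /G !patchE in_setX/= in_setT.
exact: (@measurable_fun_fubini_tonelli_F _ _ (measurableTypeR R) (measurableTypeR R) R mu G mG G0).
Qed.

(** The difference of the average and of [f s] is the average over [r] in [[0, h]]
    of [f (s + r) - f s]; by Tonelli's theorem, its norm is at most the average of
    the norms of these translation differences. *)
Lemma L1norm_average f S h e : locint f -> 0 <= S -> 0 < h -> 0 <= e ->
  (forall r, 0 <= r <= h -> (L1norm 0 S (fun s => f (s + r) - f s)%R <= e%:E)%E) ->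
  (L1norm 0 S (fun s => h^-1 * (prim f (s + h) - prim f s) - f s)%R <= e%:E)%E.
Proof.
move=> lf S0 h0 e0 fe; have mf := lf.1.
pose F (s r : R) : \bar R := `|f (s + r) - f s|%:E.
have mF : measurable_fun setT (fun z : R * R => F z.1 z.2).
  apply/measurable_EFinP; apply: measurableT_comp => //; apply: measurable_funB.
    by apply: (measurableT_comp mf); exact: measurable_funD.
  exact: (measurableT_comp mf).
have F0 x y : (0 <= F x y)%E by rewrite lee_fin.
have mP : measurable_fun setT (prim f).
  by apply: continuous_measurable_fun; exact: prim_continuous.
pose A : \bar R := (\int[mu]_(s in `[0%R, S]) (h^-1%:E * \int[mu]_(r in `[0%R, h]) F s r))%E.
apply: (@le_trans _ _ A). 
  apply: ge0_le_integral => //=.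
  - apply: measurable_normEFin; apply: measurable_funTS; apply: measurable_funB => //.
    by apply: measurable_funM => //; apply: measurable_funB => //; exact: measurable_shift.
  - apply: emeasurable_funM => //; apply: measurable_funTS; exact: measurable_integral_section.
  move=> s; rewrite in_itv/= => /andP[s0 _].
  have If : mu.-integrable `[0, h] (EFin \o (fun r => f (r + s))).
    exact: (locint_integrable _ _ _ (locint_shift f s s0 lf)).
  have Ic : mu.-integrable `[0, h] (EFin \o (fun=> f s)).
    exact: (locint_integrable _ _ _ (locint_cst (f s))).
  rewrite [X in `|X|%:E](_ : _ = h^-1 * \int[mu]_(r in `[0, h]) (f (r + s) - f s)); last first.
    rewrite RintegralB// -/(prim (fun r => f (r + s)) h) -/(prim (fun=> f s) h).
    rewrite prim_shift// ?ltW// prim_cst ?ltW// [h + s]addrC.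
    by field; rewrite gt_eqF.
  rewrite normrM gtr0_norm ?invr_gt0// EFinM lee_pmul2l//; last first.
    by rewrite lte_fin invr_gt0.
  apply: (le_trans (le_normr_Rintegral_L1norm _ _ _ _)); first exact: (locint_integrable _ _ _ (locintB _ _ (locint_shift f s s0 lf) (locint_cst (f s)))).
  rewrite le_eqVlt; apply/orP; left; apply/eqP; apply: eq_integral => r _; rewrite /F [s + r]addrC; exact: erefl.
rewrite /A ge0_integralZl//; last first.
- by rewrite lee_fin invr_ge0 ltW.
- by move=> s _; exact: integral_ge0.
- by apply: measurable_funTS; exact: measurable_integral_section.
rewrite fubini_tonelli_itv//.
rewrite -lee_pdivlMl ?invr_gt0// invrK -EFinM.
apply: (@le_trans _ _ (\int[mu]_(r in `[0%R, h]) (cst e%:E r))%E).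
  apply: ge0_le_integral => //=.
  - by move=> r _; exact: integral_ge0.
  - apply: measurable_funTS; apply: (measurable_integral_section _ (fun x y => F y x)) => //.
    apply/measurable_EFinP; apply: measurableT_comp => //; apply: measurable_funB.
      by apply: (measurableT_comp mf); exact: measurable_funD.
    exact: (measurableT_comp mf).
by rewrite integral_cst//= lebesgue_measure_itv/= lte_fin h0 -EFinB subr0 -EFinM mulrC.
Qed.

Lemma L1norm_average_cvg f S e : locint f -> 0 <= S -> 0 < e ->
  exists2 d, 0 < d & forall h, 0 < h <= d ->
  (L1norm 0 S (fun s => h^-1 * (prim f (s + h) - prim f s) - f s)%R <= e%:E)%E.
Proof.
move=> lf S0 e0.
have [d d0 dP] := L1norm_translation_cvg f S e lf.1 S0 (lf.2 _) e0.
exists d => // h /andP[h0 hd]; apply: L1norm_average => //; first exact: ltW.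
by move=> r /andP[r0 rh]; apply: dP; rewrite r0 (le_trans rh).
Qed.

End average.

(** * A semigroup is determined by its generator *)

Section abstract.
Context {R : realType} {V : normedModType R}.
Implicit Types (F : R -> V) (S T : R -> {linear V -> V}).

(** For every [e > 0], the supremum [x] of the times up to which [F] stays within
    the cone of slope [e] at [F 0] is attained by continuity, and it is [t], since the
    right derivative at [x < t] would allow to continue inside the cone. *)
Lemma right_derivative0_constant F t : 0 <= t ->
  (forall s e, 0 <= s <= t -> 0 < e -> exists2 d, 0 < d &
    forall r, 0 <= r <= t -> `|r - s| < d -> `|F r - F s| <= e) ->
  (forall s e, 0 <= s < t -> 0 < e -> exists2 d, 0 < d &
    forall h, 0 < h < d -> s + h <= t -> `|F (s + h) - F s| <= e * h) ->
  F t = F 0.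
Proof.
move=> t0 Fc Fd; apply/eqP; rewrite -subr_eq0 -normr_eq0 -(@negbK (_ == _)).
apply/negP => /eqP/eqP n0.
have {n0} n0 : 0 < `|F t - F 0| by rewrite lt_def n0 normr_ge0.
suff H e : 0 < e -> `|F t - F 0| <= e * t.
  have [t1|t1] := leP t 0.
    by move: n0; rewrite (_ : t = 0) ?subrr ?normr0 ?ltxx//; lra.
  have := H (`|F t - F 0| / (2 * t)).
  rewrite divr_gt0 ?mulr_gt0// => /(_ isT).
  rewrite (_ : _ * t = `|F t - F 0| / 2); last by field; rewrite gt_eqF.
  by lra.
move=> e0.
pose A : set R := [set s | 0 <= s <= t /\ forall r, 0 <= r <= s -> `|F r - F 0| <= e * r].
have A0 : A 0.
  split=> [|r /andP[r0 r1]]; first by rewrite lexx.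
  by rewrite (_ : r = 0) ?subrr ?normr0 ?mulr0//; lra.
have supA : has_sup A.
  by split; [exists 0|exists t => s [/andP[]]].
have [x xE] : exists x, x = sup A by exists (sup A).
have x0 : 0 <= x by rewrite xE; exact: sup_upper_bound.
have xt : x <= t by rewrite xE; apply: ge_sup => [|s [/andP[]]//]; exists 0.
have ltx r : 0 <= r < x -> `|F r - F 0| <= e * r.
  move=> /andP[r0 rx]; have [|s As rs] := @sup_adherent _ A (x - r) _ supA; first by lra.
  by apply: As.2; rewrite r0/=; move: rs; rewrite -xE; lra.
have Ax : A x.
  split; first by rewrite x0.
  move=> r /andP[r0]; rewrite le_eqVlt => /predU1P[->|rx]; last by apply: ltx; rewrite r0.
  have [x1|x1] := leP x 0; first by rewrite (_ : x = 0) ?subrr ?normr0 ?mulr0//; lra.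
  rewrite leNgt; apply/negP => gap.
  (* If the bound fails at [x], then by continuity it fails at [y < x] already. *)
  pose eta := `|F x - F 0| - e * x.
  have [||d d0 dP] := Fc x (eta / 2); [by rewrite x0|by rewrite /eta; lra|].
  pose y := Num.max (x / 2) (x - d / 2).
  have y0 : 0 <= y by rewrite le_max; apply/orP; left; lra.
  have yx : y < x by rewrite gt_max; lra.
  have xy : `|y - x| < d.
    have : x - d / 2 <= y by rewrite le_max lexx orbT.
    by rewrite ltr0_norm; lra.
  have h1 := dP y _ xy; have h2 := ltx y.
  rewrite y0 yx in h2; have {h1} h1 := h1 _.
  have {}h1 : `|F y - F x| <= eta / 2 by apply: h1; lra.
  have {}h2 := h2 isT.
  have h3 : `|F x - F 0| <= `|F y - F x| + `|F y - F 0|.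
    by rewrite (distrC (F y) (F x)); exact: ler_distD.
  have : e * y <= e * x by rewrite ler_pM2l// ltW.
  move: gap h1 h3; rewrite /eta; lra.
have [xt'|tx] := ltP x t; last first.
  have -> : t = x by lra.
  by apply: Ax.2; rewrite x0/=.
exfalso.
have [||d d0 dP] := Fd x e; [by rewrite x0|by []|].
(* A time after [x] that still satisfies the bound, against the choice of [x]. *)
pose z := Num.min (x + d / 2) t.
have zx : x < z by rewrite lt_min; lra.
have zt : z <= t by rewrite ge_min lexx orbT.
have zd : z <= x + d / 2 by rewrite ge_min lexx.
have Az : A z.
  split; first by lra.
  move=> r /andP[r0 rz]; have [rx|xr] := leP r x; first by apply: Ax.2; rewrite r0.
  have := dP (r - x); rewrite (_ : x + (r - x) = r); last by ring.
  have -> : 0 < r - x < d by lra.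
  move=> /(_ isT)/(_ (le_trans rz zt)) h1.
  have h2 : `|F x - F 0| <= e * x by apply: Ax.2; lra.
  have h3 : `|F r - F 0| <= `|F r - F x| + `|F x - F 0| by exact: ler_distD.
  by move: h1 h2 h3; lra.
by have := sup_upper_bound supA Az; rewrite -xE; lra.
Qed.

Lemma C0_semigroup_orbit_cvg T u s e : C0_semigroup T -> 0 <= s -> 0 < e ->
  exists2 d, 0 < d & forall r, 0 <= r -> `|r - s| < d -> `|T r u - T s u| <= e.
Proof.
move=> [_ _ _ /(_ u) /subspace_continuousP /(_ s)] + s0 e0.
rewrite /= in_itv/= s0 => /(_ isT)/cvgrPdist_le/(_ e e0).
move=> [d /= d0 dP]; exists d => // r r0 rs; rewrite distrC.
by apply: dP => /=; rewrite ?in_itv/= ?r0// distrC.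
Qed.

Lemma generator_cvg {D A T u} : generates D A T -> D u ->
  generator_quotient T u h @[h --> 0^'+] --> A u.
Proof.
by move=> [_ DE AE] Du; rewrite -AE//; move: (Du); rewrite -DE.
Qed.

(** [T s] commutes with the difference quotients, and is continuous. *)
Lemma generator_orbit {D A T u s} : generates D A T -> 0 <= s -> D u -> D (T s u).
Proof.
move=> gT s0 Du; have [[Tc _ Tsg _] DE AE] := gT.
rewrite -DE; apply/cvg_ex; exists (T s (A u)).
have := @cvg_comp _ _ _ _ (T s) _ _ _ (generator_cvg gT Du) (Tc s s0 (A u)).
apply: cvg_trans; apply: near_eq_cvg; near=> h.
have h0 : 0 <= h by apply: ltW; near: h; exact: nbhs_right_gt.
rewrite /= /generator_quotient linearZ linearB/= -!Tsg//.
by rewrite [s + h]addrC.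
Unshelve. all: by end_near. Qed.

(** For [v] in the domain, [s |-> S (t - s) (T s v)] is continuous and its right
    derivative is [S (t - s) (A - A) (T s v) = 0], so that its values at 0 and [t]
    agree. Local boundedness of [S] is what makes this two-variable expression
    converge; density extends the equality to all vectors. *)
Lemma semigroup_unique D A S T : generates D A S -> generates D A T ->
  (forall t, exists2 M, 0 <= M & forall s u, 0 <= s <= t -> `|S s u| <= M * `|u|) ->
  (forall u e, 0 < e -> exists2 v, D v & `|v - u| < e) ->
  forall t u, 0 <= t -> T t u = S t u.
Proof.
move=> gS gT bS dD t u t0.
have [C0S DSE ASE] := gS; have [Sc S0 Ssg _] := C0S.
have [C0T DTE ATE] := gT; have [Tc T0 Tsg _] := C0T.
have TSD v : D v -> T t v = S t v.
  move=> Dv; have [M M0 MP] := bS t.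
  pose F s := S (t - s) (T s v).
  suff : F t = F 0 by rewrite /F subrr subr0 S0 T0.
  apply: right_derivative0_constant => // s e /andP[s0 st] e0.
    set w := T s v.
    have e1 : 0 < e / 2 / (M + 1) by rewrite !divr_gt0//; lra.
    have [d1 d10 d1P] := C0_semigroup_orbit_cvg T v s _ C0T s0 e1.
    have ts0 : 0 <= t - s by lra.
    have [d2 d20 d2P] := C0_semigroup_orbit_cvg S w (t - s) (e / 2) C0S ts0 ltac:(lra).
    exists (Num.min d1 d2); first by rewrite lt_min d10.
    move=> r /andP[r0 rt]; rewrite lt_min => /andP[rs1 rs2].
    have -> : F r - F s = S (t - r) (T r v - w) + (S (t - r) w - S (t - s) w).
      by rewrite linearB/= addrA subrK.
    apply: (le_trans (ler_normD _ _)).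
    have h1 : `|S (t - r) (T r v - w)| <= e / 2.
      apply: (@le_trans _ _ (M * `|T r v - w|)); first by apply: MP; lra.
      apply: (@le_trans _ _ (M * (e / 2 / (M + 1)))).
        by rewrite ler_wpM2l//; exact: d1P.
      by rewrite mulrA ler_pdivrMr; nra.
    have h2 : `|S (t - r) w - S (t - s) w| <= e / 2.
      apply: d2P; first by lra.
      by rewrite (_ : t - r - (t - s) = s - r) 1?distrC//; ring.
    by lra.
  set w := T s v.
  have Dw : D w by exact: generator_orbit gT s0 Dv.
  have qT := generator_cvg gT Dw; have qS := generator_cvg gS Dw.
  have e1 : 0 < e / (M + 1) by rewrite divr_gt0//; lra.
  have : generator_quotient T w h - generator_quotient S w h @[h --> 0^'+] --> A w - A w.
    exact: cvgB.
  rewrite subrr => /cvgr0Pnorm_le/(_ _ e1)[d /= d0 dP].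
  exists d => // h /andP[h0 hd] sht.
  have := dP h; rewrite /= sub0r normrN gtr0_norm// => /(_ hd h0) hq.
  have -> : F (s + h) - F s = S (t - (s + h)) (h *: (generator_quotient T w h - generator_quotient S w h)).
    rewrite /F (_ : t - s = (t - (s + h)) + h); last by ring.
    rewrite (Ssg (t - (s + h)) h) ?subr_ge0//; last exact: ltW.
    transitivity (S (t - (s + h)) (T (s + h) v - S h w)); first by rewrite linearB.
    congr (S _ _).
    rewrite scalerBr /generator_quotient !scalerA mulfV ?gt_eqF// !scale1r.
    rewrite [s + h]addrC Tsg// ?ltW// -/w.
    by rewrite opprB addrA subrK.
  apply: (@le_trans _ _ (M * `|h *: (generator_quotient T w h - generator_quotient S w h)|)).
    by apply: MP; lra.
  rewrite normrZ gtr0_norm//.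
  apply: (@le_trans _ _ (M * (h * (e / (M + 1))))).
    by rewrite ler_wpM2l// ler_pM2l.
  rewrite (_ : M * _ = h * e * (M / (M + 1))); last by ring.
  rewrite [e * h]mulrC ler_piMr// ?mulr_ge0// ?ltW// ltr_pdivrMr; lra.
have Tct := Tc t t0 u; have Sct := Sc t t0 u.
apply/eqP; rewrite -subr_eq0 -normr_le0; apply/ler_addgt0Pl => e e0; rewrite addr0.
have /cvgrPdist_le/(_ e e0)/nbhs_ballP[d /= d0 dP] :
    T t v - S t v @[v --> u] --> T t u - S t u by exact: cvgB.
have [v Dv vu] := dD u d d0.
have : ball u d v by rewrite -ball_normE/= distrC.
by move=> /dP; rewrite (TSD v Dv) subrr subr0.
Qed.
End abstract.

(** * The delay equation of the outflows *)

Section delay_equation.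
Context {R : realType} {m : nat}.
Variables (c : 'I_m -> R) (K : 'M[R]_m).
Hypothesis c_gt0 : forall i, 0 < c i.
Local Notation mu := (@lebesgue_measure R).
Implicit Types (f g p q : 'I_m -> R -> R) (s t h S : R) (i j k : 'I_m).

(** The delay equation unfolded at most [n] times, which makes the recursion
    structural. *)
Fixpoint delay_sol_rec n f j s : R :=
  if n is n'.+1 then
    if s <= (c j)^-1 then f j (1 - c j * s)
    else \sum_k K j k * delay_sol_rec n' f k (s - (c j)^-1)
  else 0.

(** A positive lower bound of the delays [1/c_j]; the term 1 makes it meaningful
    even when there is no component. *)
Definition delay_bound : R := (1 + \sum_i c i)^-1.

(** Before time [n * delay_bound], unfolding [n] times is enough. *)
Definition delay_sol f j s : R := delay_sol_rec (Num.truncn (s / delay_bound)).+1 f j s.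

Definition delay_eq p := forall j s, (c j)^-1 < s ->
  p j s = \sum_k K j k * p k (s - (c j)^-1).

Lemma sum_speed_ge0 : 0 <= \sum_i c i.
Proof. by apply: sumr_ge0 => i _; exact: ltW. Qed.

Lemma delay_bound_gt0 : 0 < delay_bound.
Proof. by rewrite invr_gt0; have := sum_speed_ge0; lra. Qed.
Local Hint Resolve delay_bound_gt0 : core.

Lemma delay_bound_le j : delay_bound <= (c j)^-1.
Proof.
rewrite lef_pV2 ?posrE//; last by have := sum_speed_ge0; lra.
rewrite (bigD1 j)//=; have : 0 <= \sum_(i < m | i != j) c i.
  by apply: sumr_ge0 => i _; exact: ltW.
lra.
Qed.

(** Induction by steps of length [delay_bound], the method of steps for delay
    equations. *)
Lemma time_induction (P : R -> Prop) :
  (forall s, 0 <= s -> (forall r, 0 <= r -> r <= s - delay_bound -> P r) -> P s) ->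
  forall s, 0 <= s -> P s.
Proof.
move=> H; suff Hn n s : 0 <= s -> s < delay_bound * n%:R -> P s.
  move=> s s0; apply: (Hn (Num.truncn (s / delay_bound)).+1) => //.
  by rewrite mulrC -ltr_pdivrMr// truncnS_gt.
elim: n s => [s|n IH s s0 sn]; first by rewrite mulr0; lra.
apply: H => // r r0 rs; apply: IH => //.
by move: sn; rewrite -natr1 mulrDr mulr1; lra.
Qed.

Lemma delay_sol_rec_stable f n n' j s : s < delay_bound * n.+1%:R -> (n <= n')%N ->
  delay_sol_rec n.+1 f j s = delay_sol_rec n'.+1 f j s.
Proof.
elim: n n' j s => [|n IH] [|n'] j s sn nn'//=; case: ifPn => //; rewrite -ltNge => cs.
  by exfalso; have := delay_bound_le j; move: sn; rewrite mulr1; lra.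
apply: eq_bigr => k _; congr (_ * _); apply: IH => //.
by have := delay_bound_le j; move: sn; rewrite -(natr1 n.+1) mulrDr mulr1; lra.
Qed.

Lemma delay_sol_init f j s : s <= (c j)^-1 -> delay_sol f j s = f j (1 - c j * s).
Proof. by rewrite /delay_sol /= => ->. Qed.

Lemma delay_sol_recE f n j s : s < delay_bound * n.+1%:R -> delay_sol_rec n.+1 f j s = delay_sol f j s.
Proof.
move=> sn; have sd : s < delay_bound * (Num.truncn (s / delay_bound)).+1%:R.
  by rewrite mulrC -ltr_pdivrMr// truncnS_gt.
by have [nn|/ltnW nn] := leqP n (Num.truncn (s / delay_bound));
  [|symmetry]; exact: delay_sol_rec_stable.
Qed.

Lemma delay_sol_delay f : delay_eq (delay_sol f).
Proof.
move=> j s cs; have d0 := delay_bound_le j.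
have [n sn] : exists n, s < delay_bound * n.+2%:R.
  exists (Num.truncn (s / delay_bound)).
  rewrite (@lt_trans _ _ (delay_bound * (Num.truncn (s / delay_bound)).+1%:R))//.
    by rewrite mulrC -ltr_pdivrMr// truncnS_gt.
  by rewrite ltr_pM2l// ltr_nat.
rewrite -(delay_sol_recE f n.+1)// [LHS]/=.
rewrite leNgt cs/=; apply: eq_bigr => k _; congr (_ * _).
rewrite -(delay_sol_recE f n)//.
by move: sn; rewrite -(natr1 n.+1) mulrDr mulr1; lra.
Qed.

Lemma delay_sol_unique f p : delay_eq p ->
  (forall j s, 0 <= s <= (c j)^-1 -> p j s = f j (1 - c j * s)) ->
  forall s, 0 <= s -> forall j, p j s = delay_sol f j s.
Proof.
move=> dp pf; apply: time_induction => s s0 IH j.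
have d0 := delay_bound_le j.
have [sc|cs] := leP s (c j)^-1; first by rewrite delay_sol_init// pf// s0.
rewrite dp// delay_sol_delay//; apply: eq_bigr => k _; rewrite IH//; lra.
Qed.

Lemma delay_eq_lincomb a p q : delay_eq p -> delay_eq q ->
  delay_eq (fun j s => a * p j s + q j s).
Proof.
move=> dp dq j s cs /=; rewrite dp// dq// mulr_sumr -big_split/=.
by apply: eq_bigr => k _; ring.
Qed.

Lemma delay_eq_shift p t : 0 <= t -> delay_eq p -> delay_eq (fun j s => p j (s + t)).
Proof.
move=> t0 dp j s cs /=; rewrite dp; last by lra.
by apply: eq_bigr => k _; congr (_ * p k _); ring.
Qed.

(** By uniqueness. *)
Lemma delay_sol_lincomb a f g s j : 0 <= s ->
  delay_sol (fun j x => a * f j x + g j x) j s = a * delay_sol f j s + delay_sol g j s.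
Proof.
move=> s0; symmetry.
apply: (delay_sol_unique (fun j x => a * f j x + g j x) (fun j s => a * delay_sol f j s + delay_sol g j s)) => //.
  by apply: delay_eq_lincomb; exact: delay_sol_delay.
by move=> {}j {s0}s /andP[_ sc]; rewrite !delay_sol_init.
Qed.

Lemma delay_sol_ge0 f : (forall i j, 0 <= K i j) ->
  (forall j x, 0 <= x <= 1 -> 0 <= f j x) ->
  forall s, 0 <= s -> forall j, 0 <= delay_sol f j s.
Proof.
move=> K0 f0; apply: time_induction => s s0 IH j.
have d0 := delay_bound_le j.
have [sc|cs] := leP s (c j)^-1.
  rewrite delay_sol_init// f0//; apply/andP; split.
    by rewrite subr_ge0 -ler_pdivlMl// mulr1.
  by rewrite gerBl mulr_ge0// ltW.
rewrite delay_sol_delay//; apply: sumr_ge0 => k _; rewrite mulr_ge0//.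
by apply: IH; lra.
Qed.

(** At each time the recursion is eventually constant in the number of stages, and
    each of its stages is measurable. *)
Lemma measurable_delay_sol f j : (forall i, measurable_fun setT (f i)) ->
  measurable_fun setT (delay_sol f j).
Proof.
move=> mf.
have mrec n : forall j, measurable_fun setT (delay_sol_rec n f j).
  elim: n => [i|n IH i]; first by rewrite (_ : delay_sol_rec 0 f i = cst 0).
  rewrite (_ : delay_sol_rec _ f i = fun s =>
    if s <= (c i)^-1 then f i (1 - c i * s)
    else \sum_k K i k * delay_sol_rec n f k (s - (c i)^-1))//.
  apply: measurable_fun_ifT => //.
  - by apply: measurable_fun_ler.
  - apply: (measurableT_comp (mf i)).
    by under eq_fun do rewrite addrC -mulNr; exact: measurable_affine.
  - apply: measurable_sum => k; apply: measurable_funM => //.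
    apply: (measurableT_comp (IH k)); exact: measurable_funB.
apply: (@measurable_fun_cvg _ _ _ _ (fun n => delay_sol_rec n.+1 f j)) => // s _.
apply: cvg_near_cst; exists (Num.truncn (s / delay_bound)) => // n sn.
apply: delay_sol_recE; rewrite mulrC -ltr_pdivrMr// (lt_le_trans (truncnS_gt _))//.
by rewrite ler_nat.
Qed.

End delay_equation.

(** * L^1 bounds for the delay equation *)

Section delay_equation_bound.
Context {R : realType} {m : nat}.
Variables (c : 'I_m -> R) (K : 'M[R]_m).
Hypothesis c_gt0 : forall i, 0 < c i.
Local Notation mu := (@lebesgue_measure R).
Local Notation delay_sol := (delay_sol c K).
Implicit Types (f g p q : 'I_m -> R -> R) (s t h S : R) (i j k : 'I_m).

Lemma L1norm_delay_sol_init f j : measurable_fun setT (f j) ->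
  L1norm 0 (c j)^-1 (delay_sol f j) = ((c j)^-1%:E * L1norm 0 1 (f j))%E.
Proof.
move=> mf; have c0 := c_gt0 j.
rewrite (_ : L1norm 0 1 (f j) = L1norm (1 - c j * (c j)^-1) (1 - c j * 0) (f j)).
  rewrite L1norm_reflect// muleA -EFinM mulVf ?gt_eqF// mul1e.
  by apply: eq_L1norm => x /andP[_ xc]; rewrite delay_sol_init.
by rewrite mulfV ?gt_eqF// mulr0 subrr subr0.
Qed.

(** By steps of length [delay_bound]: what is seen at time [s] is either the datum,
    or a combination of what was seen at least one step earlier. *)
Lemma L1norm_delay_sol_bounded S : exists2 M : R, 0 <= M &
  forall f, (forall i, measurable_fun setT (f i)) -> forall j,
  (L1norm 0 S (delay_sol f j) <= M%:E * \sum_k L1norm 0 1 (f k))%E.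
Proof.
have d0 := delay_bound_gt0 c c_gt0.
suff Hn n : exists2 M : R, 0 <= M &
  forall f, (forall i, measurable_fun setT (f i)) -> forall j,
  (L1norm 0 (delay_bound c * n%:R) (delay_sol f j) <= M%:E * \sum_k L1norm 0 1 (f k))%E.
  have [M M0 MP] := Hn (Num.truncn (S / delay_bound c)).+1.
  exists M => // f mf j; apply: le_trans (MP f mf j).
  apply: L1norm_subset => //; first exact: measurable_delay_sol.
  by rewrite mulrC ltW// -ltr_pdivrMr// truncnS_gt.
elim: n => [|n [M M0 MP]].
  exists 0 => // f mf j; rewrite mulr0 mul0e /L1norm set_itv1 integral_set1//.
exists (\sum_i (c i)^-1 + \sum_i \sum_k `|K i k| * M).
  apply: addr_ge0; apply: sumr_ge0 => i _; first by rewrite invr_ge0 ltW.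
  by apply: sumr_ge0 => k _; rewrite mulr_ge0.
move=> f mf j; set N := (\sum_k _)%E.
have N0 : (0 <= N)%E by apply: sume_ge0 => k _; exact: L1norm_ge0.
have mtr k : measurable_fun setT (delay_sol f k) by exact: measurable_delay_sol.
apply: (le_trans (L1norm_split 0 _ (c j)^-1 _ (mtr j))).
rewrite EFinD ge0_muleDl ?lee_fin//; last 2 first.
- by apply: sumr_ge0 => i _; rewrite invr_ge0 ltW.
- by apply: sumr_ge0 => i _; apply: sumr_ge0 => k _; rewrite mulr_ge0.
apply: leeD.
  rewrite L1norm_delay_sol_init//; apply: lee_pmul => //.
  - by rewrite lee_fin invr_ge0 ltW.
  - exact: L1norm_ge0.
  - rewrite lee_fin (bigD1 j)//= lerDl; apply: sumr_ge0 => i _.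
    by rewrite invr_ge0 ltW.
  - rewrite /N (bigD1 j)//= leeDl//; apply: sume_ge0 => k _; exact: L1norm_ge0.
have msh k : measurable_fun setT (fun s => delay_sol f k (s - (c j)^-1)).
  exact: (measurable_shift (delay_sol f k) (- (c j)^-1)).
rewrite (@ae_eq_L1norm _ _ _ _ (fun s => \sum_k K j k * delay_sol f k (s - (c j)^-1)))//.
- apply: (le_trans (L1norm_sum _ _ _ _ _ _)).
    by move=> k; exact: measurable_funM.
  apply: (@le_trans _ _ (\sum_k (`|K j k| * M)%:E * N)%E).
    apply: lee_sum => k _; rewrite L1normZ// EFinM -muleA.
    apply: lee_wpmul2l; first by rewrite lee_fin.
    apply: le_trans (MP f mf k).
    rewrite (L1norm_shift _ _ (- (c j)^-1) (delay_sol f k))// subrr.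
    apply: L1norm_subset => //; have := delay_bound_le c c_gt0 j.
    by rewrite -natr1 mulrDr mulr1; lra.
  rewrite -ge0_sume_distrl; last by move=> k _; rewrite lee_fin mulr_ge0.
  apply: lee_wpmul2r => //; rewrite sumEFin lee_fin [leRHS](bigD1 j)//= lerDl.
  by apply: sumr_ge0 => i _; apply: sumr_ge0 => k _; rewrite mulr_ge0.
- apply: measurable_sum => k; exact: measurable_funM.
(* At the very time of the first passage, the datum is still used. *)
- have := ae_neq (c j)^-1; apply: filterS => x xc /andP[cx _].
  by rewrite delay_sol_delay// lt_neqAle cx andbT eq_sym; exact/eqP.
Qed.

End delay_equation_bound.

(** * Classes of integrable functions on the unit interval *)

#[local] Instance ae_unit_itv_filter (R : realType) :
  Filter (nbhs (almost_everywhere (unit_itv_measure R))).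
Proof. exact: (ae_filter_ringOfSetsType (unit_itv_measure R)). Qed.

Section L1I_functions.
Context {R : realType}.
Local Notation mu := (@lebesgue_measure R).
Local Notation muI := (unit_itv_measure R).
Implicit Types (f g : R -> R) (u v : L1I R).

(** The measure on the unit interval does not see the complement of the interval. *)
Lemma ae_unit_itv (P : R -> Prop) :
  (\forall x \ae muI, P x) <-> {ae mu, forall x, 0 <= x <= 1 -> P x}.
Proof.
split=> [[A [mA A0 PA]]|[A [mA A0 PA]]].
- exists (A `&` `[0, 1]); split; [exact: measurableI|exact: A0|].
  move=> x /= /not_implyP[xI Px]; split; last by rewrite in_itv.
  exact: PA.
- exists (A `|` ~` `[0, 1]); split.
  + by apply: measurableU => //; exact: measurableC.
  + rewrite /unit_itv_measure/= /mrestr setIUl setICl setU0.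
    apply/eqP; rewrite -measure_le0 -A0; apply: le_measure; rewrite ?inE//.
    exact: measurableI.
  + move=> x Px; have [xI|xI] := pselect (0 <= x <= 1); last first.
      by right; rewrite /= in_itv.
    by left; apply: PA => /(_ xI).
Qed.

Lemma integral_unit_itv (f : R -> \bar R) : measurable_fun setT f ->
  (\int[muI]_x f x = \int[mu]_(x in `[0%R, 1%R]) f x)%E.
Proof.
move=> mf.
have -> : (\int[mu]_(x in `[0%R, 1%R]) f x = \int[muI]_(x in `[0%R, 1%R]) f x)%E.
  apply: eq_measure_integral => A mA AI.
  transitivity (mu (A `&` `[0%R, 1%R])); last by [].
  by congr (mu _); symmetry; exact/setIidPl.
rewrite [RHS]integral_mkcond; apply: ae_eq_integral => //.
  by apply/(measurable_restrictT _ _).1 => //; exact: measurable_funTS.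
apply/(ae_unit_itv (fun x => setT x -> f x = (f \_ `[0, 1]) x)).
by apply: aeW => x xI _; rewrite patchE mem_set//= in_itv.
Qed.

Lemma Lfun_unit_itv f : measurable_fun setT f ->
  (f \in Lfun muI 1%E) <-> (L1norm 0 1 f < +oo)%E.
Proof.
move=> mf; have IE : (\int[muI]_x `|f x|%:E = L1norm 0 1 f)%E.
  by rewrite integral_unit_itv//; exact: measurable_normEFin.
split=> [/Lfun1_integrable/integrableP[_]|fo]; first by rewrite -IE.
apply/Lfun1_integrable/integrableP; split; first exact/measurable_EFinP.
by rewrite -IE in fo.
Qed.

Lemma measurable_L1I u : measurable_fun setT (u : R -> R).
Proof. exact: Lfun_measurable (Lspace_Lfun u). Qed.

Lemma L1I_fin u : (L1norm 0 1 u < +oo)%E.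
Proof. by apply/Lfun_unit_itv; [exact: measurable_L1I|exact: Lspace_Lfun]. Qed.

Lemma L1I_eqP u v : u = v <-> {ae mu, forall x, 0 <= x <= 1 -> u x = v x}.
Proof.
rewrite Lspace_eqP -ae_unit_itv; split; apply: filterS => x //=.
by apply.
Qed.

Lemma L1I_add u v : {ae mu, forall x, 0 <= x <= 1 -> (u + v) x = u x + v x}.
Proof. by apply/ae_unit_itv; apply: filterS (LspaceD u v) => x /(_ I). Qed.

Lemma L1I_scale k u : {ae mu, forall x, 0 <= x <= 1 -> (k *: u) x = k * u x}.
Proof. by apply/ae_unit_itv; apply: filterS (LspaceZ k u) => x /(_ I). Qed.

(** Total, with the value 0 for functions that are not integrable. *)
Definition toL1I f : L1I R :=
  if pselect (f \in Lfun muI 1%E) is left Lf then Lspace_of (lexx 1%E) Lf else 0.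

Lemma toL1IE f : measurable_fun setT f -> (L1norm 0 1 f < +oo)%E ->
  {ae mu, forall x, 0 <= x <= 1 -> toL1I f x = f x}.
Proof.
move=> mf fo; apply/ae_unit_itv; rewrite /toL1I.
case: pselect => [Lf|]; last by move/Lfun_unit_itv : fo => /(_ mf).
by apply: filterS (Lspace_ofE (lexx 1%E) Lf) => x /(_ I).
Qed.

Lemma L1I_normE u f : measurable_fun setT f ->
  {ae mu, forall x, 0 <= x <= 1 -> u x = f x} -> `|u|%:E = L1norm 0 1 f.
Proof.
move=> mf uf; rewrite Lspace_normE Lnorm1 /= integral_unit_itv; last first.
  by apply: measurable_normEFin; exact: measurable_L1I.
by apply: ae_eq_L1norm => //; exact: measurable_L1I.
Qed.

End L1I_functions.

(** * States and their outflows *)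

Section state.
Context {R : realType} {m : nat}.
Variables (c : 'I_m -> R) (K : 'M[R]_m).
Hypothesis c_gt0 : forall i, 0 < c i.
Local Notation mu := (@lebesgue_measure R).
Local Notation delay_sol := (delay_sol c K).
Local Notation X := (L1Im R m).
Implicit Types (f g p q : 'I_m -> R -> R) (s t h S : R) (i j k : 'I_m) (u v : X).

Lemma ae_nonneg_L1norm (f g : R -> R) : measurable_fun setT f -> measurable_fun setT g ->
  (forall S, L1norm 0 S (fun s => f s - g s) = 0%E) ->
  {ae mu, forall s, 0 <= s -> f s = g s}.
Proof.
move=> mf mg H; apply: ae_nonneg_bounded => n.
have ae0 := (L1norm_eq0P 0 n%:R _ (measurable_funB mf mg)).1 (H n%:R).
by apply: filterS ae0 => s h /h /eqP; rewrite subr_eq0 => /eqP.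
Qed.

(** The difference solves the delay equation with a datum of norm 0, so that the L^1
    bound makes it vanish almost everywhere. Hence the outflow of a class does not
    depend on the representative. *)
Lemma delay_sol_ae_eq f g : (forall i, measurable_fun setT (f i)) ->
  (forall i, measurable_fun setT (g i)) ->
  (forall i, {ae mu, forall x, 0 <= x <= 1 -> f i x = g i x}) ->
  forall j, {ae mu, forall s, 0 <= s -> delay_sol f j s = delay_sol g j s}.
Proof.
move=> mf mg fg j.
have md i : measurable_fun setT (fun x => -1 * g i x + f i x).
  by apply: measurable_funD => //; exact: measurable_funM.
have mtf := measurable_delay_sol c K c_gt0 f j mf.
have mtg := measurable_delay_sol c K c_gt0 g j mg.
apply: ae_nonneg_L1norm => // S.
have [M M0 MP] := L1norm_delay_sol_bounded c K c_gt0 S.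
have := MP (fun i x => -1 * g i x + f i x) md j.
rewrite big1 ?mule0; last first.
  move=> k _; apply/L1norm_eq0P => //; apply: filterS (fg k) => x h /h ->.
  by ring.
move=> H; apply/eqP; rewrite eq_le L1norm_ge0 andbT.
apply: le_trans H; rewrite le_eqVlt; apply/orP; left; apply/eqP.
by apply: eq_L1norm => x /andP[x0 _]; rewrite delay_sol_lincomb//; ring.
Qed.

Definition rep u : 'I_m -> R -> R := fun j => (u j : R -> R).

(** What leaves each component through the endpoint 1. *)
Definition outflow u := delay_sol (rep u).

Lemma measurable_rep u j : measurable_fun setT (rep u j).
Proof. exact: measurable_L1I. Qed.
Local Hint Resolve measurable_rep : core.

Lemma L1Im_normE u : `|u|%:E = (\sum_k L1norm 0 1 (rep u k))%E.
Proof.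
rewrite ffun_normE -sumEFin; apply: eq_bigr => k _.
by apply: L1I_normE => //; exact: aeW.
Qed.

Lemma outflow_bounded S : exists2 M : R, 0 <= M &
  forall u j, (L1norm 0 S (outflow u j) <= (M * `|u|)%:E)%E.
Proof.
have [M M0 MP] := L1norm_delay_sol_bounded c K c_gt0 S; exists M => // u j.
by rewrite EFinM L1Im_normE; exact: MP.
Qed.

Lemma outflow_locint u j : locint (outflow u j).
Proof.
split; first exact: measurable_delay_sol.
by move=> S; have [M _ MP] := outflow_bounded S; apply: le_lt_trans (MP u j) _; exact: ltry.
Qed.
Local Hint Resolve outflow_locint : core.

Lemma outflow_delay u : delay_eq c K (outflow u).
Proof. exact: delay_sol_delay. Qed.

(** The point [x] of the component [j] reaches the endpoint 1 at time
    [(1 - x) / c_j]. *)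
Definition pullback p j (x : R) : R := p j ((c j)^-1 - (c j)^-1 * x).

(** The state that has the beginning of [p] as its outflow. *)
Definition state p : X := [ffun j => toL1I (pullback p j)].

Lemma measurable_pullback p j : measurable_fun setT (p j) ->
  measurable_fun setT (pullback p j).
Proof.
move=> mp; apply: (measurableT_comp mp).
by under eq_fun do rewrite addrC -mulNr; exact: measurable_affine.
Qed.

Lemma L1norm_pullback p j : measurable_fun setT (p j) ->
  L1norm 0 1 (pullback p j) = ((c j)%:E * L1norm 0 (c j)^-1 (p j))%E.
Proof.
move=> mp; have c0 := c_gt0 j.
rewrite [in RHS](_ : L1norm 0 (c j)^-1 (p j) =
  L1norm ((c j)^-1 - (c j)^-1 * 1) ((c j)^-1 - (c j)^-1 * 0) (p j)).
  by rewrite L1norm_reflect ?invr_gt0// muleA -EFinM mulfV ?gt_eqF// mul1e.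
by rewrite mulr1 mulr0 subrr subr0.
Qed.

Lemma stateE p j : locint (p j) ->
  {ae mu, forall x, 0 <= x <= 1 -> state p j x = pullback p j x}.
Proof.
move=> [mp pS]; rewrite ffunE; apply: toL1IE; first exact: measurable_pullback.
by rewrite L1norm_pullback// lte_mul_pinfty// lee_fin ltW.
Qed.

Lemma state_norm p : (forall j, locint (p j)) ->
  `|state p|%:E = (\sum_j (c j)%:E * L1norm 0 (c j)^-1 (p j))%E.
Proof.
move=> lp; rewrite ffun_normE -sumEFin; apply: eq_bigr => k _.
rewrite -L1norm_pullback; last exact: (lp k).1.
apply: L1I_normE; [apply: measurable_pullback; exact: (lp k).1|exact: stateE].
Qed.

Lemma state_lincomb a p q : (forall j, locint (p j)) -> (forall j, locint (q j)) ->
  state (fun j s => a * p j s + q j s) = a *: state p + state q.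
Proof.
move=> lp lq; apply/ffunP => j; apply/L1I_eqP; rewrite !ffunE.
have l j' : locint (fun s => a * p j' s + q j' s) by apply: locintD => //; exact: locintZ.
have := stateE (fun j s => a * p j s + q j s) j (l j); have := stateE p j (lp j); have := stateE q j (lq j); rewrite !ffunE.
move=> h1 h2 h3; have h4 := L1I_add (a *: toL1I (pullback p j)) (toL1I (pullback q j)).
have h5 := L1I_scale a (toL1I (pullback p j)).
apply: filterS2 (ae_conj _ _ h1 h2) (ae_conj _ _ (ae_conj _ _ h4 h5) h3).
move=> x [H1 H2] [[H4 H5] H3] xI.
by rewrite H3// H4// H5// H1// H2.
Qed.

Lemma stateB p q : (forall j, locint (p j)) -> (forall j, locint (q j)) ->
  state (fun j s => p j s - q j s) = state p - state q.
Proof.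
move=> lp lq; rewrite -[RHS]addrC -scaleN1r -state_lincomb//; congr state.
by apply/funext => j; apply/funext => s; ring.
Qed.

Lemma stateZ a p : (forall j, locint (p j)) -> state (fun j s => a * p j s) = a *: state p.
Proof.
move=> lp; rewrite -[a in RHS](subrK 1) scalerDl scale1r -state_lincomb//.
by congr state; apply/funext => j; apply/funext => s; ring.
Qed.

Lemma state_outflow u : state (outflow u) = u.
Proof.
apply/ffunP => j; apply/L1I_eqP; have := stateE (outflow u) j (outflow_locint u j).
apply: filterS => x h xI; rewrite h// /pullback /outflow delay_sol_init.
  by rewrite /rep; congr (u j _); field; rewrite gt_eqF.
by case/andP: xI => x0 _; rewrite gerBl mulr_ge0// invr_ge0 ltW.
Qed.

Lemma state_eq p q : (forall j, locint (p j)) -> (forall j, locint (q j)) ->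
  (forall j, L1norm 0 (c j)^-1 (fun s => p j s - q j s) = 0%E) -> state p = state q.
Proof.
move=> lp lq pq; apply/eqP; rewrite -subr_eq0 -stateB// -normr_eq0 -eqe.
rewrite state_norm; last by move=> j; exact: locintB.
by rewrite big1// => j _; rewrite pq mule0.
Qed.

Lemma ae_nonneg_L1norm0 (f g : R -> R) s0 S : measurable_fun setT f -> measurable_fun setT g ->
  {ae mu, forall s, 0 <= s -> f s = g s} -> 0 <= s0 -> L1norm s0 S (fun s => f s - g s) = 0%E.
Proof.
move=> mf mg fg h0; apply/L1norm_eq0P; first exact: measurable_funB.
by apply: filterS fg => s h /andP[sS _]; rewrite h ?subrr// (le_trans h0).
Qed.

(** A solution of the delay equation is determined by its beginning, up to a
    negligible set since the class forgets the pointwise values. *)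
Lemma outflow_state p : (forall j, locint (p j)) -> delay_eq c K p ->
  forall j, {ae mu, forall s, 0 <= s -> outflow (state p) j s = p j s}.
Proof.
move=> lp dp j.
have mp i : measurable_fun setT (pullback p i).
  by apply: measurable_pullback; exact: (lp i).1.
have := delay_sol_ae_eq (rep (state p)) (pullback p) (measurable_rep _) mp
  (fun i => stateE p i (lp i)) j.
apply: filterS => s h s0; rewrite /outflow h//; symmetry.
apply: delay_sol_unique => // {h s0}i {}s /andP[s0 sc].
by rewrite /pullback; congr (p i _); field; rewrite gt_eqF.
Qed.

Lemma outflow_lincomb a u v j :
  {ae mu, forall s, 0 <= s -> outflow (a *: u + v) j s = a * outflow u j s + outflow v j s}.
Proof.
have <- : state (fun j s => a * outflow u j s + outflow v j s) = a *: u + v.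
  by rewrite state_lincomb// !state_outflow.
apply: outflow_state => [i|]; first by apply: locintD => //; exact: locintZ.
by apply: delay_eq_lincomb; exact: outflow_delay.
Qed.

Lemma state_cvg0 (F : set_system R) (p : R -> 'I_m -> R -> R) : Filter F ->
  (forall j e, 0 < e -> \forall h \near F,
     locint (p h j) /\ (L1norm 0 (c j)^-1 (p h j) <= e%:E)%E) ->
  state (p h) @[h --> F] --> (0 : X).
Proof.
move=> FF H; apply/cvgr0Pnorm_le => e e0.
have C0 : 0 < 1 + \sum_i c i by have := sum_speed_ge0 c c_gt0; lra.
have e1 : 0 < e / (1 + \sum_i c i) by rewrite divr_gt0.
have : \forall h \near F, forall j,
     locint (p h j) /\ (L1norm 0 (c j)^-1 (p h j) <= (e / (1 + \sum_i c i))%:E)%E.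
  by apply: filter_forall => j; exact: H.
apply: filterS => h Hh; rewrite -lee_fin state_norm; last by move=> j; case: (Hh j).
apply: (@le_trans _ _ (\sum_j (c j * (e / (1 + \sum_i c i)))%:E)%E).
  apply: lee_sum => j _; rewrite EFinM; apply: lee_wpmul2l; last by case: (Hh j).
  by rewrite lee_fin ltW.
rewrite sumEFin lee_fin -mulr_suml mulrA ler_pdivrMr// mulrC ler_pM2l//; lra.
Qed.

End state.

(** * The semigroup of translations of outflows *)

Section semigroup.
Context {R : realType} {m : nat}.
Variables (c : 'I_m -> R) (K : 'M[R]_m).
Hypothesis c_gt0 : forall i, 0 < c i.
Local Notation mu := (@lebesgue_measure R).
Local Notation X := (L1Im R m).
Local Notation outflow := (outflow c K).
Local Notation state := (state c).
Implicit Types (f g p q : 'I_m -> R -> R) (s t h S : R) (i j k : 'I_m) (u v : X).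

Definition time_shift t p j s : R := p j (s + t).

(** The absolute value only serves to have a value at negative times. *)
Definition evol t u : X := state (time_shift `|t| (outflow u)).

Let outflow_locint := outflow_locint c K c_gt0.
Local Hint Resolve outflow_locint : core.

Lemma locint_shift_outflow t u j : 0 <= t -> locint (time_shift t (outflow u) j).
Proof. by move=> t0; exact: locint_shift. Qed.

Lemma evolE t u : 0 <= t -> evol t u = state (time_shift t (outflow u)).
Proof. by move=> t0; rewrite /evol ger0_norm. Qed.

Lemma evol_linear t : linear (evol t).
Proof.
move=> a u v; rewrite -state_lincomb//; [|by move=> j; exact: locint_shift..].
apply: (state_eq c c_gt0).
- by move=> j; exact: locint_shift.
- by move=> j; apply: locintD; [apply: locintZ|]; exact: locint_shift.
move=> j.
have mD : measurable_fun setT (fun s => a * outflow u j s + outflow v j s).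
  by apply: (locintD _ _ _ _).1 => //; exact: locintZ.
have mS := (outflow_locint (a *: u + v) j).1.
have := L1norm_shift 0 (c j)^-1 `|t| (fun s => outflow (a *: u + v) j s - (a * outflow u j s + outflow v j s)).
rewrite /time_shift => -> //; last exact: measurable_funB.
by apply: ae_nonneg_L1norm0; rewrite ?add0r//; exact: outflow_lincomb.
Qed.

Definition evolution t : {linear X -> X} :=
  HB.pack (evol t) (GRing.isLinear.Build R X X *:%R (evol t) (evol_linear t)).

Lemma outflow_evol t u : 0 <= t -> forall j,
  {ae mu, forall s, 0 <= s -> outflow (evol t u) j s = time_shift t (outflow u) j s}.
Proof.
move=> t0; rewrite evolE//; apply: outflow_state => // [j|]; first exact: locint_shift.
by apply: delay_eq_shift => //; exact: outflow_delay.
Qed.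

Lemma evol0 u : evol 0 u = u.
Proof.
rewrite evolE// -[RHS](state_outflow c K c_gt0); congr state.
by apply/funext => j; apply/funext => s; rewrite /time_shift addr0.
Qed.

(** Translating twice the outflow of [u] is translating once, since the outflow of
    [evol t u] is the translated outflow, up to a negligible set. *)
Lemma evolD s t u : 0 <= s -> 0 <= t -> evol (s + t) u = evol s (evol t u).
Proof.
move=> s0 t0; rewrite evolE ?addr_ge0// [RHS]evolE//; apply: (state_eq c c_gt0).
- by move=> j; apply: locint_shift; rewrite ?addr_ge0.
- by move=> j; exact: locint_shift.
move=> j; have m1 := (locint_shift_outflow t u j t0).1; have m2 := (outflow_locint (evol t u) j).1.
have := L1norm_shift 0 (c j)^-1 s (fun r => time_shift t (outflow u) j r - outflow (evol t u) j r).
rewrite /time_shift => /(_ (measurable_funB m1 m2)) E.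
transitivity (L1norm (0 + s) ((c j)^-1 + s)
  (fun r => time_shift t (outflow u) j r - outflow (evol t u) j r)).
  by rewrite -E; apply: eq_L1norm => r _; rewrite /time_shift addrA.
apply: ae_nonneg_L1norm0 => //; last by rewrite add0r.
by apply: filterS (outflow_evol t u t0 j) => r h /h ->.
Qed.

(** The norm of [evol t u] is an L^1 norm of the outflow on a bounded interval of
    times. *)
Lemma evol_bounded S : exists2 M : R, 0 <= M &
  forall t u, 0 <= t <= S -> `|evol t u| <= M * `|u|.
Proof.
(* A bound of all times at which the outflow is seen by [evol t u], [t <= S]. *)
pose D := S + \sum_i (c i)^-1.
have [M M0 MP] := outflow_bounded c K c_gt0 D.
exists ((\sum_j c j) * M); first by rewrite mulr_ge0// sum_speed_ge0.
move=> t u /andP[t0 tS]; rewrite -lee_fin evolE// state_norm//; last first.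
  by move=> j; exact: locint_shift.
rewrite -mulrA mulr_suml -sumEFin; apply: lee_sum => j _; rewrite EFinM.
apply: lee_wpmul2l; first by rewrite lee_fin ltW.
apply: le_trans (MP u j).
rewrite (L1norm_shift 0 (c j)^-1 t (outflow u j)); last exact: (outflow_locint u j).1.
apply: L1norm_subset; [exact: (outflow_locint u j).1|by rewrite add0r|].
rewrite /D (bigD1 j)//=; have : 0 <= \sum_(i < m | i != j) (c i)^-1.
  by apply: sumr_ge0 => i _; rewrite invr_ge0 ltW.
lra.
Qed.

Lemma evol_right_cvg u : evol h u @[h --> 0^'+] --> u.
Proof.
have : evol h u - u @[h --> 0^'+] --> (0 : X).
  have : state (fun j s => outflow u j (s + h) - outflow u j s) @[h --> 0^'+] --> (0 : X).
    apply: state_cvg0 => // j e e0.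
    have c0 : 0 <= (c j)^-1 by rewrite invr_ge0 ltW.
    have [d d0 dP] := L1norm_translation_cvg (outflow u j) (c j)^-1 e (outflow_locint u j).1 c0
       ((outflow_locint u j).2 _) e0.
    near=> h; have h0 : 0 <= h by apply: ltW; near: h; exact: nbhs_right_gt.
    split; first by apply: locintB => //; exact: locint_shift.
    by apply: dP; rewrite h0/=; near: h; exact: nbhs_right_le.
  apply: cvg_trans; apply: near_eq_cvg; near=> h.
  have h0 : 0 <= h by apply: ltW; near: h; exact: nbhs_right_gt.
  rewrite stateB//; last by move=> j; exact: locint_shift.
  by rewrite evolE// state_outflow.
by move=> H; apply/subr_cvg0.
Unshelve. all: by end_near. Qed.

(** Continuity at a time [t] follows from right continuity at 0 by factoring out the
    evolution up to the smaller of the two times, which is uniformly bounded. *)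
Lemma evolution_C0 : C0_semigroup evolution.
Proof.
split.
- move=> t t0; apply: bounded_linear_continuous; apply/linear_boundedP.
  have [M M0 MP] := evol_bounded t.
  near=> M' => x; apply: (le_trans (MP t x _)); first by rewrite t0/=.
  by rewrite ler_wpM2r.
- exact: evol0.
- by move=> s t s0 t0 u; exact: evolD.
- move=> u; apply/subspace_continuousP => t; rewrite /= in_itv/= andbT => t0.
  apply/cvgrPdist_le => e e0.
  have [M M0 MP] := evol_bounded (t + 1).
  have e1 : 0 < e / (M + 1) by rewrite divr_gt0//; lra.
  have /cvgrPdist_le/(_ _ e1)[d /= d0 dP] := evol_right_cvg u.
  have key s r : 0 <= s -> s < r -> r <= t + 1 -> r - s < d -> `|evol s u - evol r u| <= e.
    move=> s0 sr rt rsd.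
    have -> : evol r u = evol s (evol (r - s) u).
      by rewrite -evolD//; [congr evol; ring|rewrite subr_ge0 ltW].
    rewrite -[_ - _]/(evolution s u - evolution s (evol (r - s) u)) -linearB/=.
    apply: (le_trans (MP s _ _)); first by rewrite s0/=; lra.
    apply: (@le_trans _ _ (M * (e / (M + 1)))).
      rewrite ler_wpM2l//; apply: dP; rewrite /= ?subr_gt0//.
      by rewrite sub0r normrN gtr0_norm// subr_gt0.
    by rewrite mulrA ler_pdivrMr; nra.
  exists (Num.min d 1) => /=; first by rewrite lt_min d0 ltr01.
  move=> r /=; rewrite lt_min in_itv/= andbT => /andP[td t1] r0.
  have [rt|r_gt|->] := ltgtP r t.
  + rewrite distrC; apply: key => //; first by lra.
    by move: td; rewrite gtr0_norm// subr_gt0.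
  + apply: key => //.
      by move: t1; rewrite ltr0_norm ?subr_lt0//; lra.
    by move: td; rewrite ltr0_norm ?subr_lt0//; lra.
  + by rewrite subrr normr0 ltW.
Unshelve. all: by end_near. Qed.

End semigroup.

(** * The generator in terms of outflows *)

Section generator.
Context {R : realType} {m : nat}.
Variables (c : 'I_m -> R) (K : 'M[R]_m).
Hypothesis c_gt0 : forall i, 0 < c i.
Local Notation mu := (@lebesgue_measure R).
Local Notation X := (L1Im R m).
Local Notation outflow := (outflow c K).
Local Notation state := (state c).
Local Notation evol := (evol c K).
Local Notation evolution := (evolution c K c_gt0).
Implicit Types (f p q : 'I_m -> R -> R) (s t h S : R) (i j k : 'I_m) (u v g : X).

Let outflow_locint := outflow_locint c K c_gt0.
Local Hint Resolve outflow_locint : core.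

Definition diff_quot h u j s : R := h^-1 * (outflow u j (s + h) - outflow u j s).

Lemma diff_quot_locint h u j : 0 <= h -> locint (diff_quot h u j).
Proof. by move=> h0; apply: locintZ; apply: locintB => //; exact: locint_shift. Qed.

Lemma diff_quot_delay h u : 0 <= h -> delay_eq c K (diff_quot h u).
Proof.
move=> h0 j s cs; rewrite /diff_quot (outflow_delay c K c_gt0)//; last by lra.
rewrite (outflow_delay c K c_gt0)// -sumrB mulr_sumr; apply: eq_bigr => k _.
by rewrite (_ : s + h - _ = s - (c j)^-1 + h); ring.
Qed.

Lemma generator_quotientE h u : 0 <= h ->
  generator_quotient evolution u h = state (diff_quot h u).
Proof.
move=> h0; rewrite /generator_quotient -[evolution h u]/(evol h u) evolE//.
rewrite -[X in _ *: (_ - X)](state_outflow c K c_gt0 u) -stateB//; last first.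
  by move=> j; exact: locint_shift.
by rewrite -stateZ// => j; apply: locintB => //; exact: locint_shift.
Qed.

(** This describes the graph of the generator: translation of outflows is generated
    by differentiation. *)
Definition has_outflow_deriv u g := exists C : 'I_m -> R, forall j,
  {ae mu, forall s, 0 <= s -> outflow u j s = C j + prim (outflow g j) s}.

(** The difference quotient of a primitive is an average of its derivative. *)
Lemma has_outflow_deriv_quotient_cvg u g : has_outflow_deriv u g ->
  generator_quotient evolution u h @[h --> 0^'+] --> g.
Proof.
move=> [C uC]; apply/subr_cvg0.
have : state (fun j s => diff_quot h u j s - outflow g j s) @[h --> 0^'+] --> (0 : X).
  apply: state_cvg0 => // j e e0.
  have c0 : 0 <= (c j)^-1 by rewrite invr_ge0 ltW.
  have [d d0 dP] := L1norm_average_cvg (outflow g j) (c j)^-1 e (outflow_locint g j) c0 e0.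
  have mP := continuous_measurable_fun (prim_continuous (outflow g j) (outflow_locint g j)).
  near=> h; have h0 : 0 < h by near: h; exact: nbhs_right_gt.
  have ld : locint (fun s => diff_quot h u j s - outflow g j s).
    by apply: locintB => //; apply: diff_quot_locint; exact: ltW.
  split => //; apply: (@le_trans _ _ (L1norm 0 (c j)^-1
     (fun s => h^-1 * (prim (outflow g j) (s + h) - prim (outflow g j) s) - outflow g j s))).
    rewrite le_eqVlt; apply/orP; left; apply/eqP; apply: ae_eq_L1norm.
    - exact: ld.1.
    - apply: measurable_funB; last exact: (outflow_locint g j).1.
      by apply: measurable_funM => //; apply: measurable_funB => //; exact: measurable_shift.
    have ha := ae_affine _ 1 h (oner_neq0 _) (uC j).
    apply: filterS2 (uC j) ha => s; rewrite mul1r => H1 H2 /andP[s0 _].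
    by rewrite /diff_quot H1// H2 ?addr_ge0// ?ltW//; congr (_ * _ - _); ring.
  apply: dP; rewrite h0/=; near: h; exact: nbhs_right_le.
apply: cvg_trans; apply: near_eq_cvg; near=> h.
have h0 : 0 <= h by apply: ltW; near: h; exact: nbhs_right_gt.
rewrite stateB//; last by move=> j; exact: diff_quot_locint.
by rewrite generator_quotientE// (state_outflow c K c_gt0).
Unshelve. all: by end_near. Qed.

(** Write [P] for the primitive of an outflow [y] and [V] for the one of the limit.
    Integrating the convergence over [[0, b]] gives
    [(P(b + h) - P(h) - P(b)) / h --> V(b)] for every [b]. For almost all [b], the
    part [(P(b + h) - P(b)) / h] tends to [y(b)], so that [P(h) / h] tends to
    [y(b) - V(b)], which therefore does not depend on [b]. *)
Lemma quotient_cvg_has_outflow_deriv u g :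
  generator_quotient evolution u h @[h --> 0^'+] --> g -> has_outflow_deriv u g.
Proof.
move=> ug; exists (fun j => lim (h^-1 * prim (outflow u j) h @[h --> 0^'+])) => j.
have key b : 0 <= b ->
  h^-1 * (prim (outflow u j) (b + h) - prim (outflow u j) h - prim (outflow u j) b) @[h --> 0^'+]
    --> prim (outflow g j) b.
  move=> b0; apply/cvgrPdist_le => e e0.
  have [M M0 MP] := outflow_bounded c K c_gt0 b.
  have e1 : 0 < e / (M + 1) by rewrite divr_gt0//; lra.
  have /cvgrPdist_le/(_ _ e1) nug := ug.
  near=> h; have h0 : 0 <= h by apply: ltW; near: h; exact: nbhs_right_gt.
  have hq : `|g - generator_quotient evolution u h| <= e / (M + 1).
    by near: h; exact: nug.
  pose D j s := diff_quot h u j s - outflow g j s.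
  have lD i : locint (D i) by apply: locintB => //; exact: diff_quot_locint.
  have DE : state D = generator_quotient evolution u h - g.
    rewrite stateB//; last by move=> i; exact: diff_quot_locint.
    by rewrite generator_quotientE// (state_outflow c K c_gt0).
  have dD : delay_eq c K D.
    move=> i s cs; rewrite /D diff_quot_delay// (outflow_delay c K c_gt0)// -sumrB.
    by apply: eq_bigr => k _; rewrite mulrBr.
  have -> : prim (outflow g j) b -
     h^-1 * (prim (outflow u j) (b + h) - prim (outflow u j) h - prim (outflow u j) b) = - prim (D j) b.
    rewrite primB//; last exact: diff_quot_locint.
    rewrite primZ; last by apply: locintB => //; exact: locint_shift.
    by rewrite primB ?prim_shift//; [ring|exact: locint_shift].
  rewrite normrN -lee_fin; apply: (le_trans (le_prim_L1norm _ _ _ (lD j) (lexx b))).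
  have tDE : L1norm 0 b (D j) = L1norm 0 b (outflow (state D) j).
    apply: ae_eq_L1norm; [exact: (lD j).1|exact: (outflow_locint _ j).1|].
    apply: filterS (outflow_state c K c_gt0 D lD dD j) => s h1 /andP[s0 _].
    by rewrite h1.
  rewrite tDE; apply: (le_trans (MP (state D) j)); rewrite lee_fin DE distrC.
  apply: (@le_trans _ _ (M * (e / (M + 1)))).
    by rewrite ler_wpM2l.
  by rewrite mulrA ler_pdivrMr; nra.
have := prim_derivative_ae (outflow u j) (outflow_locint u j).
apply: filterS => b Hb b0; have {Hb} Hb := Hb b0.
have : h^-1 * prim (outflow u j) h @[h --> 0^'+] --> outflow u j b - prim (outflow g j) b.
  rewrite (_ : (fun h => _) = (fun h => h^-1 * (prim (outflow u j) (b + h) - prim (outflow u j) b) -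
    h^-1 * (prim (outflow u j) (b + h) - prim (outflow u j) h - prim (outflow u j) b))).
    by apply: cvgB => //; exact: key.
  by apply/funext => h; ring.
by move/cvg_lim => ->//; ring.
Unshelve. all: by end_near. Qed.

Lemma generator_domainE : generator_domain evolution = [set u | exists g, has_outflow_deriv u g].
Proof.
apply/seteqP; split=> u /=.
  by move=> cu; exists (generator evolution u); exact: quotient_cvg_has_outflow_deriv.
by move=> [g ug]; apply/cvg_ex; exists g; exact: has_outflow_deriv_quotient_cvg.
Qed.

Lemma generatorE u g : has_outflow_deriv u g -> generator evolution u = g.
Proof. by move=> /has_outflow_deriv_quotient_cvg/cvg_lim; apply; exact: norm_hausdorff. Qed.

(** The primitive of a solution of the delay equation solves it as well, up to its
    value at the time of the first passage. *)
Lemma prim_delay p j s : (forall j, locint (p j)) -> delay_eq c K p -> (c j)^-1 <= s ->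
  prim (p j) s = prim (p j) (c j)^-1 + \sum_k K j k * prim (p k) (s - (c j)^-1).
Proof.
move=> lp dp cs; have c0 : 0 < (c j)^-1 by rewrite invr_gt0.
have := prim_shift (p j) (c j)^-1 (s - (c j)^-1) (lp j) (ltW c0).
rewrite subr_ge0 subrK => /(_ cs) /eqP; rewrite eq_sym subr_eq => /eqP ->.
rewrite addrC; congr (_ + _).
have lK k : locint (fun x => K j k * p k x) by exact: locintZ.
transitivity (prim (fun x => \sum_k K j k * p k x) (s - (c j)^-1)).
  apply: ae_eq_prim.
  - exact: (locint_shift _ _ (ltW c0) (lp j)).1.
  - exact: (locint_sum _ _ _ lK).1.
  have := ae_neq (0 : R); apply: filterS => x x0 xge0.
  rewrite dp ?ltrDr ?lt_neqAle ?xge0 ?andbT; last by rewrite eq_sym; apply/eqP.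
  by apply: eq_bigr => k _; rewrite addrK.
by rewrite prim_sum//; apply: eq_bigr => k _; rewrite primZ.
Qed.

(** The averages over [[s, s + h]] of the outflow of [u] solve the delay equation,
    are, up to constants, primitives of its difference quotient, and tend to it as [h] vanishes. *)
Lemma domain_dense u (e : R) : 0 < e ->
  exists2 v, (exists g, has_outflow_deriv v g) & `|v - u| < e.
Proof.
move=> e0; pose p h j s := h^-1 * (prim (outflow u j) (s + h) - prim (outflow u j) s).
have lp h j : locint (p h j).
  apply: locintZ; apply: locintB.
    apply: locint_continuous => x; apply: (@cvg_comp _ _ _ (fun s => s + h) (prim (outflow u j))).
      by apply: cvgD; [exact: cvg_id|exact: cvg_cst].
    exact: prim_continuous.
  by apply: locint_continuous; exact: prim_continuous.
have dp h : 0 <= h -> delay_eq c K (p h).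
  move=> h0 j s cs; have d := prim_delay (outflow u) j _ (outflow_locint u) (outflow_delay c K c_gt0 u).
  rewrite /p (d (s + h)); last by lra.
  rewrite (d s); last exact: ltW.
  rewrite opprD addrACA subrr add0r -sumrB mulr_sumr; apply: eq_bigr => k _.
  by rewrite (_ : s + h - _ = s - (c j)^-1 + h); ring.
have : state (fun j s => p h j s - outflow u j s) @[h --> 0^'+] --> (0 : X).
  apply: state_cvg0 => // j e' e'0.
  have c0 : 0 <= (c j)^-1 by rewrite invr_ge0 ltW.
  have [d d0 dP] := L1norm_average_cvg (outflow u j) (c j)^-1 e' (outflow_locint u j) c0 e'0.
  near=> h; split; first exact: locintB.
  apply: dP; apply/andP; split; first by near: h; exact: nbhs_right_gt.
  by near: h; exact: nbhs_right_le.
move=> /cvgr0Pnorm_lt/(_ e e0) H; near (0 : R)^'+ => h.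
have h0 : 0 < h by near: h; exact: nbhs_right_gt.
exists (state (p h)); last first.
  rewrite -[u in X in `|X|](state_outflow c K c_gt0) -stateB//; near: h; exact: H.
exists (state (diff_quot h u)); exists (fun j => h^-1 * prim (outflow u j) h) => j.
have lq i := diff_quot_locint h u i (ltW h0).
apply: filterS (outflow_state c K c_gt0 (p h) (lp h) (dp h (ltW h0)) j) => s H1 s0.
rewrite H1//.
rewrite (ae_eq_prim (outflow (state (diff_quot h u)) j) (diff_quot h u j)).
- rewrite primZ; last by apply: locintB => //; apply: locint_shift => //; exact: ltW.
  rewrite primB//; last by apply: locint_shift => //; exact: ltW.
  by rewrite prim_shift// ?ltW// /p; ring.
- exact: (outflow_locint _ j).1.
- exact: (lq j).1.
- by apply: outflow_state => //; apply: diff_quot_delay; exact: ltW.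
Unshelve. all: by end_near. Qed.

End generator.

(** * The flat functions built from exp (- 1/x) *)

Section smooth_step.
Context {R : realType}.
Implicit Types (f g : R -> R) (x : R).

(** The derivatives of [exp (- 1/x)] are linear combinations of these functions,
    which are all flat at 0. *)
Definition flat_exp (k : nat) (x : R) : R :=
  if 0 < x then x^-1 ^+ k * expR (- x^-1) else 0.

(** With [y = 1/x], this is [y^(k+2) <= (k+2)! exp y]. *)
Lemma flat_exp_le k x : `|x^-1 * flat_exp k x| <= (k.+2)`!%:R * `|x|.
Proof.
rewrite /flat_exp; case: ltP => x0; last by rewrite mulr0 normr0 mulr_ge0.
have y0 : 0 < x^-1 by rewrite invr_gt0.
have := expR_ge1Dxn k.+1 (ltW y0).
rewrite ger0_norm; last by rewrite mulr_ge0 ?mulr_ge0 ?expR_ge0 ?exprn_ge0 ?ltW.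
rewrite (gtr0_norm x0) => H.
(* The term of degree [k + 2] of the exponential series at [1/x]. *)
have F0 : 0 < (k.+2)`!%:R :> R by rewrite ltr0n fact_gt0.
have {}H : x^-1 ^+ k.+2 <= (k.+2)`!%:R * expR x^-1.
  by rewrite -ler_pdivrMl// mulrC; lra.
rewrite mulrA -exprS expRN ler_pdivrMr ?expR_gt0//.
rewrite -(ler_pM2l y0) -exprS (le_trans H)// le_eqVlt; apply/orP; left; apply/eqP.
by field; rewrite gt_eqF.
Qed.

Lemma is_derive_flat_exp k x :
  is_derive x 1 (flat_exp k) (flat_exp k.+2 x - k%:R * flat_exp k.+1 x).
Proof.
have [x0|x0|->] := ltgtP x 0.
- rewrite {2 3}/flat_exp !ltNge (ltW x0)/= mulr0 subrr.
  apply: (@near_eq_is_derive _ _ _ (cst (0 : R))). 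
  have /cvgr_lt/(_ 0 x0) : (y : R) @[y --> x] --> x by exact: cvg_id.
  apply: filterS => y y0.
  by rewrite /flat_exp ltNge ltW.
- rewrite {2 3}/flat_exp x0.
  apply: (@near_eq_is_derive _ _ _ (fun x => x^-1 ^+ k * expR (- x^-1))).
    have /cvgr_gt/(_ 0 x0) : (y : R) @[y --> x] --> x by exact: cvg_id.
    apply: filterS => y y0.
    by rewrite /flat_exp y0.
  have xn0 : x != 0 by rewrite gt_eqF.
  have dV : is_derive x 1 (fun y : R => y^-1) (- x ^- 2 *: 1).
    exact: (@is_deriveV _ id x 1 _ xn0 (is_derive_id x 1)).
  have dE : is_derive x 1 (fun y : R => expR (- y^-1)) (expR (- x^-1) * x ^- 2).
    have dN : is_derive x 1 (fun y : R => - y^-1) (x ^- 2).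
      apply: (is_derive_eq (is_deriveN dV)).
      by rewrite scaleNr opprK /GRing.scale/= mulr1.
    exact: (@is_derive1_comp _ expR (fun y : R => - y^-1) x _ _ (is_derive_expR _) dN).
  have dX : is_derive x 1 (fun y : R => y^-1 ^+ k) (- k%:R * x^-1 ^+ k.+1).
    case: k => [|n].
      by rewrite oppr0 mul0r; exact: is_derive_cst.
    have -> : (fun y : R => y^-1 ^+ n.+1) = (fun y : R => y^-1) ^+ n.+1.
      by apply/funext => y; rewrite exprfctE.
    apply: (is_derive_eq (is_deriveX n.+1 dV)).
    rewrite /GRing.scale/= mulr1 -exprVn !exprS; ring.
  apply: (is_derive_eq (is_deriveM dX dE)).
  rewrite /GRing.scale/= -exprVn !exprS; ring.
- rewrite {2 3}/flat_exp !ltxx mulr0 subrr.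
  have H : h^-1 *: (flat_exp k (h *: 1 + 0) - flat_exp k 0) @[h --> (0 : R)^'] --> (0 : R).
    apply/cvgr0Pnorm_le => e e0.
    have F0 : 0 < (k.+2)`!%:R :> R by rewrite ltr0n fact_gt0.
    near=> h; rewrite {2}/flat_exp ltxx subr0 addr0 [h *: 1]mulr1.
    apply: (le_trans (flat_exp_le k h)); rewrite -ler_pdivlMl// mulrC.
    near: h; apply: dnbhs0_le; exact: divr_gt0.
  apply: DeriveDef; first by apply/cvg_ex; exists 0.
  exact/cvg_lim.
Unshelve. all: by end_near. Qed.

End smooth_step.

(** * Test functions *)

Section test_functions.
Context {R : realType}.
Local Notation mu := (@lebesgue_measure R).
Implicit Types (f g h phi : R -> R) (x a b : R).

(** Closed under derivation and containing the functions needed, hence consisting of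
    smooth functions. *)
Inductive bump_class : (R -> R) -> Prop :=
| bump_flat k : bump_class (flat_exp k)
| bump_affine f a b : bump_class f -> bump_class (fun x => f (a * x + b))
| bump_scale a f : bump_class f -> bump_class (fun x => a * f x)
| bump_add f g : bump_class f -> bump_class g -> bump_class (fun x => f x + g x)
| bump_mul f g : bump_class f -> bump_class g -> bump_class (fun x => f x * g x).

Lemma bump_class_derive f : bump_class f ->
  exists2 g, bump_class g & forall x, is_derive x 1 f (g x).
Proof.
elim=> {f} [k|f a b _ [g cg fg]|a f _ [g cg fg]|f1 f2 _ [g1 cg1 fg1] _ [g2 cg2 fg2]|
  f1 f2 cf1 [g1 cg1 fg1] cf2 [g2 cg2 fg2]].
- exists (fun x => flat_exp k.+2 x + (- k%:R) * flat_exp k.+1 x).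
    by apply: bump_add; [|apply: bump_scale]; exact: bump_flat.
  by move=> x; apply: (is_derive_eq (is_derive_flat_exp k x)); rewrite mulNr.
- exists (fun x => a * g (a * x + b)); first exact/bump_scale/bump_affine.
  move=> x; have dA : is_derive x 1 (fun y : R => a * y + b) a.
    apply: (is_derive_eq (is_deriveD (is_deriveZ a (is_derive_id x 1)) (is_derive_cst b x 1))).
    by rewrite addr0 /GRing.scale/= mulr1.
  rewrite mulrC.
  exact: (@is_derive1_comp _ f (fun y : R => a * y + b) x _ _ (fg _) dA).
- exists (fun x => a * g x); first exact: bump_scale.
  by move=> x; exact: (is_deriveZ a (fg x)).
- exists (fun x => g1 x + g2 x); first exact: bump_add.
  by move=> x; exact: (is_deriveD (fg1 x) (fg2 x)).
- exists (fun x => f1 x * g2 x + f2 x * g1 x).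
    by apply: bump_add; exact: bump_mul.
  by move=> x; exact: (is_deriveM (fg1 x) (fg2 x)).
Qed.

Lemma bump_class_derive1n n f : bump_class f -> bump_class f^`(n)%classic.
Proof.
elim: n f => // n IH f cf; rewrite derive1Sn; apply: IH.
have [g cg fg] := bump_class_derive f cf.
suff -> : f^`()%classic = g by [].
by apply/funext => x; rewrite derive1E; case: (fg x).
Qed.

Lemma bump_class_derivable f n x : bump_class f -> derivable f^`(n)%classic x 1.
Proof.
move=> /(bump_class_derive1n n)/bump_class_derive[g _ fg].
by case: (fg x).
Qed.

Lemma derivable_continuous f : (forall x, derivable f x 1) -> continuous f.
Proof.
by move=> df x; apply: differentiable_continuous; apply/derivable1_diffP; exact: df.
Qed.

Lemma bump_class_continuous f : bump_class f -> continuous f.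
Proof. by move=> cf; apply: derivable_continuous => x; exact: (bump_class_derivable f 0). Qed.

(** The primitive of a smooth function supported in [[lo, hi]] with integral 0 is
    supported there as well. *)
Lemma prim_test_function f lo hi : bump_class f -> 0 < lo -> lo < hi -> hi < 1 ->
  (forall y, y < lo -> f y = 0) -> (forall y, hi <= y -> f y = 0) -> prim f hi = 0 ->
  test_function (prim f) /\ (prim f)^`()%classic = f.
Proof.
move=> cf lo0 lohi hi1 flo fhi fI.
have cont := bump_class_continuous f cf; have lf := locint_continuous f cont.
have dP x : is_derive x 1 (prim f) (f x).
  have [xlo|lox] := ltP x lo.
    rewrite flo//; apply: (@near_eq_is_derive _ _ _ (cst (0 : R))).
    have /cvgr_lt/(_ lo xlo) : (y : R) @[y --> x] --> x by exact: cvg_id.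
    by apply: filterS => y ylo; rewrite (prim_eq0 f lo).
  exact: (is_derive_prim f x lf (lt_le_trans lo0 lox) (cont x)).
have dE : (prim f)^`()%classic = f.
  by apply/funext => x; rewrite derive1E; case: (dP x).
have supp : closure [set x | prim f x != 0] `<=` `[lo, hi].
  rewrite [X in _ `<=` X](closure_id _).1; last exact: interval_closed.
  apply: closure_subset => x /= px; rewrite in_itv/=; apply/andP; split.
    by rewrite leNgt; apply: contra_neqN px => xlo; exact: (prim_eq0 f lo).
  rewrite leNgt; apply: contra_neqN px => hix.
  by rewrite (prim_constant f hi)// (ltW hix) andbT ltW// (lt_trans lo0).
split=> //; split.
- move=> [|n] x; first by case: (dP x).
  by rewrite derive1Sn dE; exact: bump_class_derivable.
- apply: subclosed_compact supp; [exact: closed_closure|exact: segment_compact].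
- apply: (subset_trans supp) => x /=; rewrite !in_itv/= => /andP[h1 h2].
  by rewrite (lt_le_trans lo0)//= (le_lt_trans h2).
Qed.

End test_functions.

(** * The lemma of du Bois-Reymond *)

Section du_bois_reymond.
Context {R : realType}.
Local Notation mu := (@lebesgue_measure R).
Implicit Types (f g h phi : R -> R) (x a b e : R).

(** A smooth function supported in [[a, a + e]]; it tends to the indicator function
    of its interior as [k] grows, since [flat_exp 0] tends to 1 at infinity. *)
Definition window (k a e x : R) : R :=
  flat_exp 0 (k * x + - (k * a)) * flat_exp 0 (- k * x + k * (a + e)).

Lemma flat_exp0_itv x : 0 <= flat_exp 0 x <= 1.
Proof.
rewrite /flat_exp; case: ltP => x0; last by rewrite lexx ler01.
rewrite expr0 mul1r expR_ge0/= -expR0 ler_expR oppr_le0 invr_ge0 ltW//.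
Qed.

Lemma flat_exp_eq0 k x : x <= 0 -> flat_exp k x = 0.
Proof. by rewrite /flat_exp leNgt => /negbTE ->. Qed.

Lemma window_class k a e : bump_class (window k a e).
Proof.
by apply: bump_mul; apply: (bump_affine (flat_exp 0)); exact: bump_flat.
Qed.

Lemma window_itv k a e x : 0 <= window k a e x <= 1.
Proof.
have /andP[h1 h2] := flat_exp0_itv (k * x + - (k * a)).
have /andP[h3 h4] := flat_exp0_itv (- k * x + k * (a + e)).
by rewrite /window mulr_ge0//= mulr_ile1.
Qed.

Lemma window_left k a e x : 0 < k -> x <= a -> window k a e x = 0.
Proof. by move=> k0 xa; rewrite /window flat_exp_eq0 ?mul0r//; nra. Qed.

Lemma window_right k a e x : 0 < k -> a + e <= x -> window k a e x = 0.
Proof. by move=> k0 xa; rewrite /window mulrC flat_exp_eq0 ?mul0r//; nra. Qed.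

Lemma flat_exp_cvg1 x : 0 < x -> flat_exp 0 (n.+1%:R * x) @[n --> \oo] --> (1 : R).
Proof.
move=> x0; have H : expR (- (x^-1 * harmonic n)) @[n --> \oo] --> (1 : R).
  rewrite -expR0; apply: continuous_cvg; first exact: continuous_expR.
  rewrite -oppr0 -[X in - X](mulr0 x^-1); apply: cvgN; apply: cvgMr.
  exact: cvg_harmonic.
apply: cvg_trans H; apply: near_eq_cvg; apply: nearW => n.
rewrite /flat_exp mulr_gt0// expr0 mul1r /harmonic/=.
by congr expR; field; rewrite gt_eqF//= pnatr_eq0.
Qed.

Lemma window_cvg a e x :
  window n.+1%:R a e x @[n --> \oo] --> (if a < x < a + e then 1 else 0 : R).
Proof.
case: ifPn => [/andP[ax xe]|nx].
  rewrite -[X in _ --> X](mulr1 1); apply: cvgM.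
    have := flat_exp_cvg1 (x - a); rewrite subr_gt0 => /(_ ax).
    by under eq_cvg do rewrite mulrBr.
  have := flat_exp_cvg1 (a + e - x); rewrite subr_gt0 => /(_ xe).
  by under eq_cvg do rewrite mulrBr addrC -mulNr.
apply: cvg_near_cst; apply: nearW => n; have k0 : 0 < n.+1%:R :> R by [].
have [ax|ax] := leP x a; first exact: window_left.
by apply: window_right => //; move: nx; rewrite ax/= -leNgt.
Qed.

Lemma window_integral_cvg h a e : locint h -> 0 <= a -> 0 < e -> a + e <= 1 ->
  \int[mu]_(x in `[0, 1]) (h x * window n.+1%:R a e x) @[n --> \oo] -->
  \int[mu]_(x in `[a, a + e]) h x.
Proof.
move=> lh a0 e0 ae1.
have Ih := locint_integrable h 0 1 lh (lexx 0).
have mw k : measurable_fun setT (window k a e).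
  by apply: continuous_measurable_fun; apply: bump_class_continuous; exact: window_class.
have -> : \int[mu]_(x in `[a, a + e]) h x = \int[mu]_(x in `[0, 1]) (h \_ `]a, a + e[) x.
  rewrite -Rintegral_mkcondr.
  have -> : `[0, 1]%classic `&` `]a, a + e[%classic = `]a, a + e[%classic :> set R.
    apply/seteqP; split=> x /=; rewrite !in_itv/=; first by case.
    by move=> /andP[h1 h2]; split; apply/andP; split => //; lra.
  have IS (D : set R) : measurable D -> D `<=` `[a, a + e] -> mu.-integrable D (EFin \o h).
    by move=> mD Dae; exact: integrableS (locint_integrable h a (a + e) lh a0).
  rewrite -Rintegral_itv_bndo_bndc; last first.
    by apply: IS => // x /=; rewrite !in_itv/= => /andP[-> /ltW].
  rewrite -Rintegral_itv_obnd_cbnd//.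
  by apply: IS => // x /=; rewrite !in_itv/= => /andP[/ltW -> /ltW].
have mhw n : measurable_fun setT (fun x => h x * window n.+1%:R a e x).
  by apply: measurable_funM => //; exact: lh.1.
have [|||||Hi _ H] := @dominated_convergence _ _ _ mu `[0, 1]%classic (measurable_itv _)
    (fun n x => (h x * window n.+1%:R a e x)%:E) (EFin \o (h \_ `]a, a + e[))
    (fun x => `|h x|%:E).
- by move=> n; apply/measurable_EFinP; apply: measurable_funTS; exact: mhw.
- apply/measurable_EFinP; apply: measurable_funTS; apply/(measurable_restrictT _ _).1 => //.
  by apply: measurable_funTS; exact: lh.1.
- apply: aeW => x _; apply: cvg_EFin; first exact: nearW.
  have -> : (h \_ `]a, a + e[) x = h x * (if a < x < a + e then 1 else 0).
    rewrite patchE mem_setE in_itv/=; case: ifPn => _; first by rewrite mulr1.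
    by rewrite mulr0.
  by apply: cvgMr; exact: window_cvg.
- exact: (integrable_norm Ih).
- apply: aeW => x n _; rewrite /= lee_fin normrM ler_piMr//.
  by have /andP[h1 h2] := window_itv n.+1%:R a e x; rewrite ger0_norm.
rewrite /Rintegral; apply: fine_cvg; rewrite fineK//.
exact: integrable_fin_num.
Qed.

(** The difference of the two windows at [a] and [b] has integral 0, hence is the
    derivative of a test function; as [k] grows, the windows tend to the indicator
    functions of the two intervals. *)
Lemma weak0_average h a b e : locint h ->
  (forall phi, test_function phi -> \int[mu]_(x in `[0, 1]) (h x * phi^`()%classic x) = 0) ->
  0 < a -> a <= b -> 0 < e -> b + e < 1 ->
  \int[mu]_(x in `[a, a + e]) h x = \int[mu]_(x in `[b, b + e]) h x.
Proof.
move=> lh h0 a0 ab e0 be1.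
have ca := window_integral_cvg h a e lh (ltW a0) e0 ltac:(lra).
have cb := window_integral_cvg h b e lh ltac:(lra) e0 ltac:(lra).
suff H n : \int[mu]_(x in `[0, 1]) (h x * window n.+1%:R a e x) =
           \int[mu]_(x in `[0, 1]) (h x * window n.+1%:R b e x).
  have E : (fun n => \int[mu]_(x in `[0, 1]) (h x * window n.+1%:R a e x)) =
           (fun n => \int[mu]_(x in `[0, 1]) (h x * window n.+1%:R b e x)) by apply/funext.
  rewrite E in ca; exact: (cvg_unique (@norm_hausdorff R R^o) ca cb).
have k0 : 0 < n.+1%:R :> R by [].
set k : R := n.+1%:R in k0 *.
pose D x := window k a e x + -1 * window k b e x.
have cD : bump_class D.
  by apply: bump_add; [|apply: bump_scale]; exact: window_class.
have lw r : locint (window k r e).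
  by apply: locint_continuous; apply: bump_class_continuous; exact: window_class.
have D1 y : y < a -> D y = 0.
  by move=> ya; rewrite /D !window_left ?mulr0 ?addr0//; lra.
have D2 y : b + e <= y -> D y = 0.
  by move=> yb; rewrite /D !window_right ?mulr0 ?addr0//; lra.
have pD : prim D (b + e) = 0.
  rewrite primD//; last exact: locintZ.
  rewrite primZ// mulN1r.
  (* The windows are translates of each other, hence have the same integral. *)
  have -> : window k a e = (fun x => window k b e (x + (b - a))).
    by apply/funext => x; rewrite /window; congr (flat_exp _ _ * flat_exp _ _); ring.
  rewrite prim_shift//; [|lra..].
  rewrite (prim_constant (window k b e) (b + e) (b + e + (b - a)))//; last first.
  - by apply/andP; split; lra.
  - by move=> y yb; exact: window_right.
  rewrite (prim_eq0 (window k b e) b (b - a)); [by rewrite subr0 subrr| |lra].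
  by move=> y yb; apply: window_left => //; exact: ltW.
have [tD dD] := prim_test_function D a (b + e) cD a0 ltac:(lra) be1 D1 D2 pD.
have := h0 _ tD; rewrite dD.
have I r : mu.-integrable `[0, 1] (EFin \o (fun x => h x * window k r e x)).
  apply: locint_integrable => //; apply: locintM_continuous => //.
  by apply: bump_class_continuous; exact: window_class.
have -> : (fun x => h x * D x) = (fun x => h x * window k a e x - h x * window k b e x).
  by apply/funext => x; rewrite /D; ring.
rewrite RintegralB; [|exact: measurable_itv|exact: I|exact: I].
by move=> /eqP; rewrite subr_eq0 => /eqP.
Qed.

(** The averages of [h] over intervals of equal length are equal, so that its values
    at Lebesgue points are equal; the midpoint 1/2 serves as a common reference. *)
Lemma weak0_constant h : locint h ->
  (forall phi, test_function phi -> \int[mu]_(x in `[0, 1]) (h x * phi^`()%classic x) = 0) ->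
  exists C : R, {ae mu, forall x, 0 <= x <= 1 -> h x = C}.
Proof.
move=> lh h0.
(* The constant is the common limit of the averages. *)
exists (lim (e^-1 * (prim h (2^-1 + e) - prim h 2^-1) @[e --> 0^'+])).
have := prim_derivative_ae h lh; apply: filterS3 (ae_neq 0) (ae_neq 1) => x x0 x1 Hx xI.
have {}xI : 0 < x < 1.
  by case/andP: xI; rewrite !le_eqVlt => /predU1P[/esym//|->] /predU1P[//|->].
have {Hx} Hx := Hx ltac:(lra).
suff : e^-1 * (prim h (2^-1 + e) - prim h 2^-1) @[e --> 0^'+] --> h x.
  by move/cvg_lim => ->.
apply: cvg_trans Hx; apply: near_eq_cvg; near=> e.
have e0 : 0 < e by near: e; exact: nbhs_right_gt.
have e1 : e < 1 - x by near: e; apply: nbhs_right_lt; lra.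
have e2 : e < 2^-1 by near: e; apply: nbhs_right_lt; lra.
rewrite !prim_sub//; [|lra..]; congr (_ * _).
have [x2|x2] := leP x 2^-1.
  by apply: weak0_average => //; lra.
by symmetry; apply: weak0_average => //; lra.
Unshelve. all: by end_near. Qed.

End du_bois_reymond.

(** * Weakly differentiable functions are primitives *)

Section weak_derivative.
Context {R : realType}.
Local Notation mu := (@lebesgue_measure R).
Local Notation muI := (unit_itv_measure R).
Implicit Types (f g h phi : R -> R) (x a b e C : R) (u v : L1I R).

Lemma test_function_derive phi : test_function phi ->
  [/\ forall x, derivable phi x 1, continuous phi, continuous (phi^`()%classic),
      phi 0 = 0 & phi 1 = 0].
Proof.
move=> [dphi _ supp]; have d0 x : derivable phi x 1 by exact: (dphi 0).
have d1 x : derivable (phi^`()%classic) x 1 by exact: (dphi 1).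
split; [exact: d0|exact: derivable_continuous|exact: derivable_continuous| |].
- apply/eqP/negPn/negP => p0; have := supp 0 (@subset_closure _ [set x | phi x != 0] 0 p0).
  by rewrite /= in_itv/= ltxx.
- apply/eqP/negPn/negP => p0; have := supp 1 (@subset_closure _ [set x | phi x != 0] 1 p0).
  by rewrite /= in_itv/= ltxx andbF.
Qed.

Lemma integration_by_parts_continuous C g phi : continuous g -> test_function phi ->
  \int[mu]_(x in `[0, 1]) ((C + prim g x) * phi^`()%classic x) =
  - \int[mu]_(x in `[0, 1]) (g x * phi x).
Proof.
move=> cg /test_function_derive[dphi cphi cphi' p0 p1].
have lg := locint_continuous g cg; have cP := prim_continuous g lg.
have cF : continuous (fun x => C + prim g x).
  by move=> x; apply: cvgD; [exact: cvg_cst|exact: cP].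
have dF x : 0 < x -> is_derive x 1 (fun x => C + prim g x) (g x).
  move=> x0; have dP := is_derive_prim g x lg x0 (cg x).
  by apply: (is_derive_eq (is_deriveD (is_derive_cst C x 1) dP)); rewrite add0r.
rewrite (@Rintegration_by_parts _ (fun x => C + prim g x) phi g (phi^`()%classic)).
- by rewrite p0 p1 !mulr0 subrr sub0r.
- exact: ltr01.
- exact: continuous_subspaceT.
- split.
  + by move=> x; rewrite in_itv/= => /andP[x0 _]; case: (dF x x0).
  + by apply: cvg_at_right_filter; exact: cF.
  + by apply: cvg_at_left_filter; exact: cF.
- by move=> x; rewrite in_itv/= => /andP[x0 _]; rewrite derive1E; case: (dF x x0).
- exact: continuous_subspaceT.
- split.
  + by move=> x _; exact: dphi.
  + by apply: cvg_at_right_filter; exact: cphi.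
  + by apply: cvg_at_left_filter; exact: cphi.
- by [].
Qed.

(** The bound behind the continuity in L^1 of both sides of the integration by parts. *)
Lemma Rintegral01_le f w N B : locint f -> continuous w ->
  (forall x, 0 <= x <= 1 -> `|w x| <= B) -> 0 <= B ->
  (L1norm 0 1 f <= N%:E)%E -> `|\int[mu]_(x in `[0, 1]) (f x * w x)| <= B * N.
Proof.
move=> lf cw wB B0 fN; have lfw := locintM_continuous f w lf cw.
rewrite -lee_fin; apply: (le_trans (le_normr_Rintegral_L1norm _ _ _ _)).
  exact: locint_integrable.
apply: (@le_trans _ _ (L1norm 0 1 (fun x => B * f x))).
  apply: le_L1norm; [exact: lfw.1|exact: (locintZ f B lf).1|].
  by move=> x /wB xB; rewrite !normrM mulrC ler_wpM2r// [leRHS]ger0_norm.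
rewrite L1normZ; last exact: lf.1.
by rewrite ger0_norm// EFinM; apply: lee_wpmul2l; rewrite ?lee_fin.
Qed.

(** Both sides are continuous in [g] for the L^1 norm, and continuous functions are
    dense. The constant [C] disappears as [phi] vanishes at both endpoints. *)
Lemma integration_by_parts_prim C g phi : locint g -> test_function phi ->
  \int[mu]_(x in `[0, 1]) ((C + prim g x) * phi^`()%classic x) =
  - \int[mu]_(x in `[0, 1]) (g x * phi x).
Proof.
move=> lg tphi; have [_ cphi cphi' _ _] := test_function_derive phi tphi.
set phi' := phi^`()%classic in cphi' *.
have [A A0 phi'A] := continuous_bounded_itv phi' 0 1 cphi'.
have [B B0 phiB] := continuous_bounded_itv phi 0 1 cphi.
have I (f k : R -> R) : locint f -> continuous k ->
    mu.-integrable `[0, 1] (EFin \o (fun x => f x * k x)).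
  by move=> lf ck; apply: locint_integrable => //; exact: locintM_continuous.
apply/eqP; rewrite -subr_eq0 opprK -normr_le0; apply/ler_addgt0Pl => e e0; rewrite addr0.
have [q q0 ABq] : exists2 q, 0 < q & A * q + B * q <= e.
  exists (e / (A + B + 1)); first by rewrite divr_gt0//; lra.
  by rewrite -mulrDl mulrA ler_pdivrMr ?[e * _]mulrC ?ler_wpM2r ?(ltW e0)//; lra.
have muI1 : (mu `[0%R, 1%R]%classic < +oo)%E by rewrite lebesgue_measure_itv/= lte_fin ltr01 ltry.
have [g_ [cg _ gg]] := approximation_continuous_integrable (measurable_itv _) muI1
  (locint_integrable g 0 1 lg (lexx 0)).
have [n gn] : exists n, (L1norm 0 1 (fun x => g x - g_ n x)%R < q%:E)%E.
  move/fine_cvgP : gg => [gfin /(cvgr_lt 0)/(_ _ q0) glt].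
  have [n [/= gfin_n glt_n]] := filter_ex (filterI gfin glt).
  by exists n; rewrite /L1norm -(fineK gfin_n) lte_fin.
have lgn := locint_continuous (g_ n) (cg n).
have ld := locintB g (g_ n) lg lgn.
have lP f : locint f -> locint (prim f).
  by move=> lf; apply: locint_continuous; exact: prim_continuous.
have lCP f : locint f -> locint (fun x => C + prim f x).
  by move=> lf; apply: locintD; [exact: locint_cst|exact: lP].
have := integration_by_parts_continuous C (g_ n) phi (cg n) tphi; rewrite -/phi' => IBP.
have E1 : \int[mu]_(x in `[0, 1]) ((C + prim g x) * phi' x) =
   \int[mu]_(x in `[0, 1]) ((C + prim (g_ n) x) * phi' x) +
   \int[mu]_(x in `[0, 1]) (prim (fun x => g x - g_ n x) x * phi' x).
  rewrite -RintegralD//; [|exact: I (lCP _ lgn) cphi'|exact: I (lP _ ld) cphi'].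
  by apply: eq_Rintegral => x _; rewrite primB//; ring.
have E2 : \int[mu]_(x in `[0, 1]) (g x * phi x) =
   \int[mu]_(x in `[0, 1]) (g_ n x * phi x) +
   \int[mu]_(x in `[0, 1]) ((g x - g_ n x) * phi x).
  rewrite -RintegralD//; [|exact: I|exact: I ld cphi].
  by apply: eq_Rintegral => x _; ring.
rewrite E1 E2 IBP (_ : - ?[a] + ?[b] + (?a + ?[d]) = ?b + ?d); last by ring.
apply: (le_trans (ler_normD _ _)).
have B1 : `|\int[mu]_(x in `[0, 1]) (prim (fun x => g x - g_ n x) x * phi' x)|
    <= A * q.
  apply: Rintegral01_le => //; first exact: lP.
  have -> : q%:E = (q * (1 - 0))%:E by rewrite subr0 mulr1.
  apply: L1norm_le_cst => //; first exact: (lP _ ld).1.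
  move=> x /andP[_ x1]; rewrite -lee_fin; apply: le_trans (ltW gn).
  exact: le_prim_L1norm.
have B2 : `|\int[mu]_(x in `[0, 1]) ((g x - g_ n x) * phi x)| <= B * q.
  by apply: Rintegral01_le => //; exact: ltW.
exact: (le_trans (lerD B1 B2) ABq).
Qed.

(** Values of representatives outside the unit interval are arbitrary; they are
    discarded to obtain a function integrable on bounded intervals. *)
Definition cut f := f \_ `[0, 1].

Lemma cutE f x : 0 <= x <= 1 -> cut f x = f x.
Proof. by move=> xI; rewrite /cut patchE mem_set//= in_itv. Qed.

Lemma cut_locint f : measurable_fun setT f -> (L1norm 0 1 f < +oo)%E -> locint (cut f).
Proof.
move=> mf fo.
have mc : measurable_fun setT (cut f).
  by apply/(measurable_restrictT _ _).1 => //; exact: measurable_funTS.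
split=> // S; apply: (le_lt_trans (L1norm_split 0 S 1 _ mc)).
rewrite lte_add_pinfty//.
  by rewrite (eq_L1norm _ _ _ f)// => x; exact: cutE.
rewrite (_ : L1norm 1 S (cut f) = 0%E)//; apply/L1norm_eq0P => //.
have := ae_neq (1 : R); apply: filterS => x x1 /andP[x1' _].
rewrite /cut patchE memNset//= in_itv/= => /andP[_ x1''].
by apply: x1; apply/eqP; rewrite eq_le x1''.
Qed.

Lemma L1I_cut_locint u : locint (cut u).
Proof. by apply: cut_locint; [exact: measurable_L1I|exact: L1I_fin]. Qed.

Lemma prim_cut f x : x <= 1 -> prim (cut f) x = prim f x.
Proof. by move=> x1; apply: eq_prim => y /andP[y0 yx]; rewrite cutE// y0 (le_trans yx). Qed.

Lemma Rintegral_unit_itv u f k : measurable_fun setT f -> continuous k ->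
  {ae mu, forall x, 0 <= x <= 1 -> u x = f x} ->
  \int[muI]_x (u x * k x) = \int[mu]_(x in `[0, 1]) (f x * k x).
Proof.
move=> mf ck uf; have mk := continuous_measurable_fun ck.
rewrite /Rintegral integral_unit_itv; last first.
  by apply/measurable_EFinP; apply: measurable_funM => //; exact: measurable_L1I.
congr fine; apply: ae_eq_integral => //.
- apply/measurable_EFinP; apply: measurable_funTS; apply: measurable_funM => //.
  exact: measurable_L1I.
- by apply/measurable_EFinP; apply: measurable_funTS; exact: measurable_funM.
- by apply: filterS uf => x /= H; rewrite in_itv/= => /H ->.
Qed.

(** A primitive of the weak derivative differs from the function by one of zero weak
    derivative, which is constant. *)
Lemma weak_derivativeP u v : is_weak_derivative u v <->
  exists C, {ae mu, forall x, 0 <= x <= 1 -> u x = C + prim v x}.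
Proof.
have lu := L1I_cut_locint u; have lv := L1I_cut_locint v.
have lP : locint (prim (cut v)) by apply: locint_continuous; exact: prim_continuous.
have uE : {ae mu, forall x, 0 <= x <= 1 -> u x = cut u x}.
  by apply: aeW => x xI; rewrite cutE.
have vE : {ae mu, forall x, 0 <= x <= 1 -> v x = cut v x}.
  by apply: aeW => x xI; rewrite cutE.
split=> [wd|[C uC] phi tphi].
- have [] := weak0_constant (fun x => cut u x - prim (cut v) x).
  + exact: locintB.
  + move=> phi tphi; have [_ cphi cphi' _ _] := test_function_derive phi tphi.
    have := wd phi tphi.
    rewrite (Rintegral_unit_itv u (cut u) _ lu.1 cphi' uE).
    rewrite (Rintegral_unit_itv v (cut v) _ lv.1 cphi vE).
    have := integration_by_parts_prim 0 (cut v) phi lv tphi.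
    under eq_Rintegral do rewrite add0r.
    move=> <- H; under eq_Rintegral do rewrite mulrBl.
    rewrite RintegralB//.
    * by rewrite H subrr.
    * by apply: locint_integrable => //; exact: locintM_continuous.
    * by apply: locint_integrable => //; exact: locintM_continuous.
  + move=> C p; exists C; move: p; apply: filterS => x H xI.
    have := H xI; rewrite cutE// prim_cut; last by case/andP: xI.
    by lra.
- have [_ cphi cphi' _ _] := test_function_derive phi tphi.
  rewrite (Rintegral_unit_itv v (cut v) _ lv.1 cphi vE).
  rewrite -(integration_by_parts_prim C (cut v) phi lv tphi).
  apply: Rintegral_unit_itv => //; first exact: (locintD _ _ (locint_cst C) lP).1.
  by apply: filterS uC => x H xI; rewrite H// prim_cut//; case/andP: xI.
Qed.

End weak_derivative.

(** * Traces and weak derivatives *)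

Section sobolev.
Context {R : realType}.
Local Notation mu := (@lebesgue_measure R).
Implicit Types (f g : R -> R) (x a b e C : R) (u v : L1I R).

(** Otherwise the functions differ on a neighbourhood in the interval, which contains
    an interval of positive length. *)
Lemma ae_eq_within_continuous f g : {within `[0, 1], continuous f} ->
  {within `[0, 1], continuous g} -> {ae mu, forall x, 0 <= x <= 1 -> f x = g x} ->
  forall x, 0 <= x <= 1 -> f x = g x.
Proof.
move=> cf cg fg x xI; apply: contrapT => /eqP; rewrite -subr_eq0 -normr_gt0 => d0.
have xI' : `[0, 1]%classic x by rewrite /= in_itv.
have : (fun y => f y - g y) @ within `[0, 1] (nbhs x) --> f x - g x.
  by apply: cvgB; [move/subspace_continuousP : cf|move/subspace_continuousP : cg]; exact.
move=> /cvgrPdist_lt/(_ _ d0)[d /= d0' dP].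
pose a := Num.max 0 (x - d / 2); pose b := Num.min 1 (x + d / 2).
have [a0 ax] : 0 <= a /\ x - d / 2 <= a by rewrite !le_max !lexx orbT.
have [b1 bx] : b <= 1 /\ b <= x + d / 2 by rewrite !ge_min !lexx orbT.
have ab : a < b.
  by rewrite lt_min !gt_max; apply/andP; split; apply/andP; split; lra.
have [y /andP[ay yb] fgy] := ae_exists _ a b ab fg.
have yI : 0 <= y <= 1 by lra.
have := dP y; rewrite /= in_itv/= => /(_ _ yI); rewrite (fgy yI) subrr subr0 ltxx.
by move=> H; have : false by apply: H; rewrite ltr_norml; lra.
Qed.

Lemma continuous_reprE u f x : continuous f ->
  {ae mu, forall y, 0 <= y <= 1 -> u y = f y} -> 0 <= x <= 1 ->
  continuous_repr u x = f x.
Proof.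
move=> cf uf; rewrite /continuous_repr.
set S := (X in xget _ X); have [cr ru] : S (xget (u : R -> R) S).
  apply: (xgetPex (u : R -> R)); exists f; split; first exact: continuous_subspaceT.
  by apply/ae_unit_itv; apply: filterS uf => y H yI _; rewrite H.
apply: ae_eq_within_continuous => //; first exact: continuous_subspaceT.
have := (ae_unit_itv _).1 ru.
by apply: filterS2 uf => y H1 H2 yI; rewrite H2// H1.
Qed.

Lemma prim_L1I_scale a u x : x <= 1 -> prim (a *: u) x = a * prim u x.
Proof.
move=> x1; have lu := L1I_cut_locint u.
rewrite -(prim_cut u)// -primZ// -prim_cut//.
apply: ae_eq_prim; [exact: (L1I_cut_locint _).1|exact: (locintZ _ _ lu).1|].
apply: filterS (L1I_scale a u) => y Hy y0.
have [y1|y1] := leP y 1; first by rewrite !cutE ?y0// Hy ?y0.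
by rewrite /cut !patchE !memNset ?mulr0//= in_itv/= => /andP[_]; rewrite leNgt y1.
Qed.

(** The primitive of the difference is constant, hence has derivative 0 almost
    everywhere. *)
Lemma weak_derivative_unique u (g1 g2 : L1I R) :
  is_weak_derivative u g1 -> is_weak_derivative u g2 -> g1 = g2.
Proof.
move=> /weak_derivativeP[C1 u1] /weak_derivativeP[C2 u2].
pose d x := cut g1 x - cut g2 x.
have l1 := L1I_cut_locint g1; have l2 := L1I_cut_locint g2.
have ld : locint d by exact: locintB.
have dC x : 0 <= x <= 1 -> prim d x = C2 - C1.
  apply: (ae_eq_within_continuous (prim d) (fun=> C2 - C1)).
  - by apply: continuous_subspaceT; exact: prim_continuous.
  - by apply: continuous_subspaceT => y; exact: cvg_cst.
  apply: filterS2 u1 u2 => y H1 H2 yI; rewrite primB// !prim_cut; [|by lra..].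
  by move: (H1 yI) (H2 yI); lra.
apply/L1I_eqP; apply: filterS2 (ae_neq 1) (prim_derivative_ae d ld) => x x1 Hx xI.
have {}x1 : x < 1 by rewrite lt_neqAle; apply/andP; split; [exact/eqP|case/andP: xI].
have : h^-1 * (prim d (x + h) - prim d x) @[h --> 0^'+] --> (0 : R).
  apply: cvg_near_cst; near=> h.
  have h0 : 0 < h by near: h; exact: nbhs_right_gt.
  have h1 : h < 1 - x by near: h; apply: nbhs_right_lt; lra.
  by rewrite !dC ?subrr ?mulr0//; lra.
have Hx' : h^-1 * (prim d (x + h) - prim d x) @[h --> 0^'+] --> d x by apply: Hx; lra.
move=> /(cvg_unique (@norm_hausdorff R R^o) Hx').
by rewrite /d !cutE// => /eqP; rewrite subr_eq0 => /eqP.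
Unshelve. all: by end_near. Qed.

Lemma weak_derivativeE u (g : L1I R) : is_weak_derivative u g -> weak_derivative u = g.
Proof.
move=> ug; apply: xget_subset1 => // g1 g2.
exact: weak_derivative_unique.
Qed.

End sobolev.

(** * The transport operator generates the semigroup of outflows *)

Section transport_generator.
Context {R : realType} {m : nat}.
Variables (c : 'I_m -> R) (K : 'M[R]_m).
Hypothesis c_gt0 : forall i, 0 < c i.
Local Notation mu := (@lebesgue_measure R).
Local Notation X := (L1Im R m).
Local Notation outflow := (outflow c K).
Local Notation state := (state c).
Local Notation evolution := (evolution c K c_gt0).
Local Notation has_outflow_deriv := (has_outflow_deriv c K).
Implicit Types (p q : 'I_m -> R -> R) (s t h x : R) (i j k : 'I_m) (u v g : X).

Let outflow_locint := outflow_locint c K c_gt0.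
Local Hint Resolve outflow_locint : core.

(** Until the first passage, the outflow is the state run backwards at speed
    [c_j]. *)
Lemma prim_outflow g j x : 0 <= x <= 1 ->
  prim (outflow g j) ((c j)^-1 - (c j)^-1 * x) = (c j)^-1 * (prim (g j) 1 - prim (g j) x).
Proof.
move=> /andP[x0 x1]; have c0 := c_gt0 j; have ci0 : 0 < (c j)^-1 by rewrite invr_gt0.
have lg := L1I_cut_locint (g j).
rewrite -!(prim_cut (g j))// prim_sub//; last by rewrite x0.
set b := (c j)^-1 - (c j)^-1 * x.
have E1 : 1 - c j * b = x by rewrite /b; field; rewrite gt_eqF.
have := Rintegral_reflect 0 b (c j) 1 (cut (g j)) lg.1 c0.
rewrite mulr0 subr0 E1 => /(_ (locint_integrable _ _ _ lg x0)) <-.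
rewrite mulrA mulVf ?gt_eqF// mul1r; apply: eq_Rintegral => s.
rewrite inE/= in_itv/= => /andP[s0 sb].
have cs : c j * s <= 1 - x by rewrite -E1 (_ : _ - _ = c j * b) ?ler_pM2l//; ring.
have cs0 : 0 <= c j * s by rewrite mulr_ge0// ltW.
rewrite /outflow delay_sol_init; last by rewrite -[leRHS]mulr1 ler_pdivlMl//; lra.
by rewrite cutE//; lra.
Qed.

Lemma outflow_pullback u j x : 0 <= x <= 1 -> pullback c (outflow u) j x = u j x.
Proof.
move=> /andP[x0 x1]; rewrite /pullback /outflow delay_sol_init.
  by rewrite /rep; congr (u j _); field; rewrite gt_eqF.
by rewrite gerBl mulr_ge0// invr_ge0 ltW.
Qed.

Lemma ae_pullback (P : R -> Prop) j : {ae mu, forall s, 0 <= s -> P s} ->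
  {ae mu, forall x, 0 <= x <= 1 -> P ((c j)^-1 - (c j)^-1 * x)}.
Proof.
have ci0 : 0 < (c j)^-1 by rewrite invr_gt0.
have n0 : - (c j)^-1 != 0 by rewrite oppr_eq0 gt_eqF.
move=> /(ae_affine _ (- (c j)^-1) (c j)^-1 n0); apply: filterS => x H /andP[x0 x1].
by rewrite addrC -mulNr; apply: H; rewrite mulNr addrC subr_ge0 ler_piMr// ltW.
Qed.

(** The boundary condition is read off at any one time after the first passage:
    there, the delay equations of the outflow of [u] and of the primitive of the
    outflow of [g] differ by exactly this condition. *)
Lemma has_outflow_deriv_domain u g : has_outflow_deriv u g ->
  transport_domain K u /\ transport c u = g.
Proof.
move=> [C uC].
have uE j : {ae mu, forall x, 0 <= x <= 1 ->
    u j x = C j + prim (outflow g j) ((c j)^-1 - (c j)^-1 * x)}.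
  have := ae_pullback _ j (uC j); apply: filterS => x H xI.
  by rewrite -outflow_pullback// /pullback H.
have wd j : is_weak_derivative (u j) (- (c j)^-1 *: g j).
  apply/weak_derivativeP; exists (C j + (c j)^-1 * prim (g j) 1).
  apply: filterS (uE j) => x H xI; rewrite H// prim_outflow//.
  have x1 : x <= 1 by case/andP: xI.
  rewrite prim_L1I_scale//.
  by ring.
have cF j : continuous (fun x => C j + prim (outflow g j) ((c j)^-1 - (c j)^-1 * x)).
  move=> x; apply: cvgD; first exact: cvg_cst.
  apply: (@cvg_comp _ _ _ (fun x => (c j)^-1 - (c j)^-1 * x) (prim (outflow g j))).
    by apply: cvgB; [exact: cvg_cst|apply: cvgMr; exact: cvg_id].
  exact: prim_continuous.
have repr j x : 0 <= x <= 1 ->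
    continuous_repr (u j) x = C j + prim (outflow g j) ((c j)^-1 - (c j)^-1 * x).
  by move=> xI; exact: (continuous_reprE (u j) _ x (cF j) (uE j) xI).
split.
- split; first by move=> j; exists (- (c j)^-1 *: g j).
  apply/matrixP => j o; rewrite !mxE repr ?lexx ?ler01// mulr0 subr0.
  have -> : \sum_k K j k * point_value u 1 k o = \sum_k K j k * C k.
    apply: eq_bigr => k _; rewrite mxE repr ?lexx ?ler01// mulr1 subrr prim0//.
    by rewrite addr0.
  have ci0 : 0 < (c j)^-1 by rewrite invr_gt0.
  have shifted : {ae mu, forall s, (c j)^-1 <= s -> forall k,
      outflow u k (s - (c j)^-1) = C k + prim (outflow g k) (s - (c j)^-1)}.
    suff : {ae mu, forall s, forall k, (c j)^-1 <= s ->
        outflow u k (s - (c j)^-1) = C k + prim (outflow g k) (s - (c j)^-1)}.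
      by apply: filterS => s H cs k; exact: H.
    apply: filter_forall => k.
    have := ae_affine _ 1 (- (c j)^-1) (oner_neq0 _) (uC k).
    by apply: filterS => s; rewrite mul1r => H cs; apply: H; rewrite subr_ge0.
  (* Any time after the first passage does. *)
  have [s /andP[s1 s2] [H1 H2]] := ae_exists _ ((c j)^-1 + 1) ((c j)^-1 + 2) ltac:(lra)
    (ae_conj _ _ (uC j) shifted).
  have cs : (c j)^-1 < s by lra.
  have := H1 (ltW (lt_trans ci0 cs)).
  rewrite (outflow_delay c K c_gt0)// (prim_delay c K c_gt0 (outflow g))//; last 2 first.
  + exact: outflow_delay.
  + exact: ltW.
  rewrite (eq_bigr (fun k => K j k * C k + K j k * prim (outflow g k) (s - (c j)^-1))).
    by rewrite big_split/= => E; lra.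
  by move=> k _; rewrite (H2 (ltW cs)) mulrDr.
- apply/ffunP => j; rewrite ffunE (weak_derivativeE _ _ (wd j)) scalerA.
  by rewrite mulrNN mulfV ?gt_eqF// scale1r.
Qed.

(** The primitive [W] of the outflow of [transport c u] that starts at [u(1)] solves
    the delay equation, thanks to the boundary condition, and it agrees with the
    outflow of [u] until the first passage. So both are equal. *)
Lemma domain_has_outflow_deriv u : transport_domain K u -> has_outflow_deriv u (transport c u).
Proof.
move=> [wu bu]; set g := transport c u.
pose d j := weak_derivative (u j).
have wd j : is_weak_derivative (u j) (d j).
  by have [d' ud'] := wu j; rewrite /d (weak_derivativeE _ _ ud').
have gE j : g j = - c j *: d j by rewrite /g ffunE.
have [D uD] : exists D : 'I_m -> R, forall j,
    {ae mu, forall x, 0 <= x <= 1 -> u j x = D j + prim (d j) x}.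
  exists (fun j => projT1 (cid ((weak_derivativeP _ _).1 (wd j)))) => j.
  exact: (projT2 (cid ((weak_derivativeP _ _).1 (wd j)))).
have prim_g j x : x <= 1 -> prim (g j) x = - c j * prim (d j) x.
  by move=> x1; rewrite gE prim_L1I_scale.
have repr j x : 0 <= x <= 1 -> continuous_repr (u j) x = D j + prim (d j) x.
  move=> xI; rewrite (continuous_reprE (u j) (fun x => D j + prim (cut (d j)) x))//.
  - by rewrite prim_cut//; case/andP: xI.
  - move=> y; apply: cvgD; [exact: cvg_cst|apply: prim_continuous].
    exact: L1I_cut_locint.
  - by apply: filterS (uD j) => y H yI; rewrite H// prim_cut//; case/andP: yI.
(* [D j] and [C j] are the values of [u_j] at 0 and at 1. *)
pose C j := D j + prim (d j) 1.
have DC j : D j = \sum_k K j k * C k.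
  move/matrixP : bu => /(_ j 0); rewrite !mxE repr ?lexx ?ler01// prim0// addr0 => ->.
  by apply: eq_bigr => k _; rewrite mxE repr ?lexx ?ler01.
pose W j s := C j + prim (outflow g j) s.
have lW j : locint (W j).
  by apply: locintD; [exact: locint_cst|apply: locint_continuous; exact: prim_continuous].
have pc j x : 0 <= x <= 1 ->
    prim (outflow g j) ((c j)^-1 - (c j)^-1 * x) = prim (d j) x - prim (d j) 1.
  move=> xI; rewrite prim_outflow// !prim_g//; last by case/andP: xI.
  by field; rewrite gt_eqF.
have dW : delay_eq c K W.
  move=> j s cs; rewrite /W (prim_delay c K c_gt0 (outflow g))//; last 2 first.
  - exact: outflow_delay.
  - exact: ltW.
  have := pc j 0; rewrite lexx ler01 mulr0 subr0 => /(_ isT) ->.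
  under [RHS]eq_bigr do rewrite mulrDr.
  by rewrite big_split/= -DC prim0// /C; ring.
have uW : state W = u.
  apply/ffunP => j; apply/L1I_eqP; have := stateE c c_gt0 W j (lW j).
  apply: filterS2 (uD j) => x H1 H2 xI; rewrite H2// H1// /pullback /W pc// /C.
  by ring.
exists C => j; have := outflow_state c K c_gt0 W lW dW j.
by rewrite uW.
Qed.

Lemma evolution_generates : generates (transport_domain K) (transport c) evolution.
Proof.
split; first exact: evolution_C0.
- rewrite generator_domainE; apply/seteqP; split=> u /=.
    by move=> [g /has_outflow_deriv_domain[]].
  by move=> /domain_has_outflow_deriv ug; exists (transport c u).
- by move=> u /domain_has_outflow_deriv; exact: generatorE.
Qed.

Lemma transport_semigroup_unique (T : R -> {linear X -> X}) :
  generates (transport_domain K) (transport c) T ->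
  forall t u, 0 <= t -> T t u = evol c K t u.
Proof.
move=> gT; apply: (semigroup_unique _ _ evolution T evolution_generates gT).
- move=> t; have [M M0 MP] := evol_bounded c K c_gt0 t; exists M; [exact: M0|move=> s u; exact: MP].
- move=> u e e0; have [v [g vg] vu] := domain_dense c K c_gt0 u e e0.
  by exists v => //; case: (has_outflow_deriv_domain v g vg).
Qed.

End transport_generator.

(** * Positivity *)

Section positivity.
Context {R : realType} {m : nat}.
Variables (c : 'I_m -> R) (K : 'M[R]_m).
Hypothesis c_gt0 : forall i, 0 < c i.
Local Notation mu := (@lebesgue_measure R).
Local Notation X := (L1Im R m).
Local Notation outflow := (outflow c K).
Local Notation evol := (evol c K).
Implicit Types (s t x : R) (i j k : 'I_m) (u : X).

Lemma ae_evol t u j : 0 <= t -> {ae mu, forall x, 0 <= x <= 1 ->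
  evol t u j x = outflow u j ((c j)^-1 - (c j)^-1 * x + t)}.
Proof.
by move=> t0; rewrite evolE//; apply: (stateE c c_gt0); exact: locint_shift_outflow.
Qed.

(** The representatives are replaced by their positive parts, which changes the
    outflow on a negligible set only and makes it nonnegative everywhere. *)
Lemma evol_nonneg t u : (forall i j, 0 <= K i j) -> 0 <= t ->
  nonneg_L1 u -> nonneg_L1 (evol t u).
Proof.
move=> K0 t0 u0 j; apply/ae_unit_itv.
pose f k x : R := Num.max 0 (u k x).
have tr0 : {ae mu, forall s, 0 <= s -> 0 <= outflow u j s}.
  have := delay_sol_ae_eq c K c_gt0 (rep u) f (measurable_rep u) _ _ j.
  move=> /(_ _ _) H; apply: filterS (H _ _) => [s Hs s0|k|k].
  - by rewrite /outflow Hs//; apply: delay_sol_ge0 => // i x _; rewrite le_max lexx.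
  - by apply: measurable_maxr => //; exact: measurable_rep.
  - apply: filterS ((ae_unit_itv _).1 (u0 k)) => x Hx xI.
    by rewrite /f /rep max_r// Hx.
have trt0 : {ae mu, forall s, 0 <= s -> 0 <= outflow u j (s + t)}.
  have := ae_affine _ 1 t (oner_neq0 _) tr0; apply: filterS => s.
  by rewrite mul1r => H s0; apply: H; rewrite addr_ge0.
have := ae_pullback c c_gt0 _ j trt0.
by apply: filterS2 (ae_evol t u j t0) => x H1 H2 xI; rewrite H1// H2.
Qed.

(** At time [t = delay_bound], no particle has passed twice, and the part [x < c_i t]
    of the component [i] contains what entered from the component [j] alone, namely
    [K_ij]. *)
Lemma evol_nonneg_boundary : (forall t u, 0 <= t -> nonneg_L1 u -> nonneg_L1 (evol t u)) ->
  forall i j, 0 <= K i j.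
Proof.
move=> pos i j; have ci0 := c_gt0 i; have cV0 : 0 < (c i)^-1 by rewrite invr_gt0.
pose f k (x : R) : R := (k == j)%:R.
have mf k : measurable_fun setT (f k) by exact: measurable_cst.
pose u : X := [ffun k => toL1I (f k)].
have uE k : {ae mu, forall x, 0 <= x <= 1 -> u k x = f k x}.
  by rewrite ffunE; apply: toL1IE => //; exact: (locint_cst _).2.
have u0 : nonneg_L1 u.
  by move=> k; apply/ae_unit_itv; apply: filterS (uE k) => x H /H ->; rewrite ler0n.
pose t := delay_bound c.
have t0 : 0 < t by exact: delay_bound_gt0.
have tr_f : {ae mu, forall s, 0 <= s -> outflow u i s = delay_sol c K f i s}.
  exact: (delay_sol_ae_eq c K c_gt0 (rep u) f (measurable_rep u) mf uE i).
have trt : {ae mu, forall s, 0 <= s -> outflow u i (s + t) = delay_sol c K f i (s + t)}.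
  have := ae_affine _ 1 t (oner_neq0 _) tr_f; apply: filterS => s.
  by rewrite mul1r => H s0; apply: H; rewrite addr_ge0// ltW.
have ae1 := (ae_unit_itv _).1 (pos t u (ltW t0) u0 i).
have ct : c i * t / 2 <= 1.
  have : c i * t <= c i * (c i)^-1 by rewrite ler_pM2l// delay_bound_le.
  rewrite mulfV ?gt_eqF//.
  by lra.
have b0 : 0 < c i * t / 2 by rewrite divr_gt0// mulr_gt0.
have [x /andP[x0 xb] [H1 [H2 H3]]] := ae_exists _ 0 _ b0
  (ae_conj _ _ ae1 (ae_conj _ _ (ae_evol t u i (ltW t0)) (ae_pullback c c_gt0 _ i trt))).
have xI : 0 <= x <= 1 by rewrite x0 (le_trans xb).
have := H1 xI; rewrite (H2 xI) (H3 xI).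
have xt : (c i)^-1 * x <= t / 2 by rewrite ler_pdivrMl// mulrA.
have xc0 : 0 <= (c i)^-1 * x by rewrite mulr_ge0// ltW.
rewrite delay_sol_delay//; last by lra.
rewrite (bigD1 j)//= big1 ?addr0; last first.
  move=> k kj; rewrite delay_sol_init /f ?(negbTE kj) ?mulr0//.
  by have := delay_bound_le c c_gt0 k; rewrite -/t; lra.
rewrite delay_sol_init /f ?eqxx ?mulr1//.
by have := delay_bound_le c c_gt0 j; rewrite -/t; lra.
Qed.

End positivity.

Theorem theorem3p1 (R : realType) (m : nat) (c : 'I_m -> R) (K : 'M[R]_m)
    (c_gt0 : forall i, 0 < c i) :
  (exists T : R -> {linear L1Im R m -> L1Im R m},
     generates (transport_domain K) (transport c) T) /\
  (forall T : R -> {linear L1Im R m -> L1Im R m},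
     generates (transport_domain K) (transport c) T ->
     (positive_semigroup T <-> forall i j, 0 <= K i j)).
Proof.
split; first by exists (evolution c K c_gt0); exact: evolution_generates.
move=> T gT; have TE := transport_semigroup_unique c K c_gt0 T gT.
split=> [posT|K0 t t0 u u0].
  apply: (evol_nonneg_boundary c K c_gt0) => t u t0 u0.
  by rewrite -TE//; exact: posT.
by rewrite TE//; exact: evol_nonneg.
Qed.
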